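(* There exists an absolute constant $c>0$ such that for every positive integer $n$ there is an origin-symmetric convex body $L$ in $\mathbb{R}^n$ such that for any $p\ge 1$, $$d_{ovr}(L,L_p^n)\ge c\,\frac{\sqrt n}{\sqrt p}.$$
   Context: $|A|$ denotes Lebesgue volume in $\mathbb{R}^n$. Here $1\le p<\infty$. $L_p^n$ denotes the collection of origin-symmetric convex bodies in $\mathbb{R}^n$ that are linear images of unit balls of $n$-dimensional subspaces of the Banach space $L_p$. For an origin-symmetric convex body $K\subset\mathbb{R}^n$, the outer volume ratio of $K$ to the subspaces of $L_p$ is $$d_{ovr}(K,L_p^n)=\inf_{D\in L_p^n:\,K\subset D}\left(\frac{|D|}{|K|}\right)^{\frac1n}.$$ *)

(* Defs.v *)
From HB Require Import structures.
From mathcomp Require Import all_boot all_order all_algebra.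
From mathcomp Require Import all_classical all_reals all_analysis.

Set Implicit Arguments.
Unset Strict Implicit.
Unset Printing Implicit Defensive.

Import Order.TTheory GRing.Theory Num.Theory.
Import numFieldNormedType.Exports.

Local Open Scope classical_set_scope.
Local Open Scope ring_scope.

(* MathComp-Analysis has no Lebesgue measure on R^n for general n: it is built
   here as the n-fold product of [lebesgue_measure], on the Borel (product)
   sigma-algebra of [n.-tuple R]. *)
Section lebesgue_tuple.
Context {R : realType}.
Local Open Scope ereal_scope.

Local Notation T := (measurableTypeR R).

Definition tuple_cons n (z : T * n.-tuple T) : n.+1.-tuple T :=
  [tuple of z.1 :: z.2].

Fixpoint lebesgue_tuple n : set (n.-tuple T) -> \bar R :=
  match n with
  | 0 => dirac ([tuple] : 0.-tuple T)
  | m.+1 => pushforward (lebesgue_measure \x @lebesgue_tuple m) (@tuple_cons m)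
  end.
Arguments lebesgue_tuple : clear implicits.

Lemma measurable_tuple_cons n : measurable_fun setT (@tuple_cons n).
Proof.
by apply: measurable_cons; [exact: measurable_fst | exact: measurable_snd].
Qed.

Lemma lebesgue_tuple_measure n :
  exists mu : {sigma_finite_measure set (n.-tuple T) -> \bar R},
    mu = lebesgue_tuple n :> (set _ -> \bar R).
Proof.
elim: n => [|n [mu muE]].
  by exists (dirac ([tuple] : 0.-tuple T)).
pose uncons (t : n.+1.-tuple T) : T * n.-tuple T :=
  (tnth t ord0, [tuple of behead t]).
have consK : cancel (@tuple_cons n) uncons.
  by move=> [x t]; congr pair; exact/val_inj.
have munc : measurable_fun setT uncons.
  apply/measurable_fun_pairP; split; first exact: measurable_tnth.
  exact: measurable_behead.
pose lmu : {measure set (T * n.-tuple T)%type -> \bar R} :=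
  lebesgue_measure \x mu.
have lmu_fin : sigma_finite setT lmu.
  have /sigma_finiteP[F [FT ndF Foo]] := sigma_finiteT (@lebesgue_measure R).
  have /sigma_finiteP[G [GT ndG Goo]] := sigma_finiteT mu.
  exists (fun k => F k `*` G k).
    rewrite -setXTT FT GT predeqE => -[x y]; split.
      move=> [/= [i _ Fix] [j _ Gjy]]; exists (maxn i j) => //; split.
      - by move: x Fix; exact/subsetPset/ndF/leq_maxl.
      - by move: y Gjy; exact/subsetPset/ndG/leq_maxr.
    by move=> [i _ []/= ? ?]; split; exists i.
  move=> k; have [? ?] := Foo k; have [? ?] := Goo k.
  split; first exact: measurableX.
  by rewrite /lmu/= product_measure1E// lte_mul_pinfty// ge0_fin_numE.
pose nu : {measure set (n.+1.-tuple T) -> \bar R} :=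
  measure_function_pushforward__canonical__measure_function_Measure
    lmu (@measurable_tuple_cons n).
have nu_fin : sigma_finite setT nu.
  have [F FT Fmu] := lmu_fin.
  exists (fun k => uncons @^-1` F k).
    by rewrite -preimage_bigcup -FT preimage_setT.
  move=> k; have [mF Foo] := Fmu k; split.
    by rewrite -[X in measurable X]setTI; exact: munc.
  rewrite /= /pushforward -comp_preimage.
  by rewrite (_ : _ @^-1` F k = F k)//; apply/seteqP; split=> z /=; rewrite consK.
pose nuM := Measure_isSigmaFinite.Build _ _ _ nu nu_fin.
pose nu' : {sigma_finite_measure set (n.+1.-tuple T) -> \bar R} :=
  HB.pack (nu : set _ -> \bar R) nu nuM.
by exists nu'; rewrite /= -muE.
Qed.

Let lebesgue_tuple0 n : lebesgue_tuple n set0 = 0.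
Proof. by have [mu <-] := lebesgue_tuple_measure n; exact: measure0. Qed.

Let lebesgue_tuple_ge0 n A : 0 <= lebesgue_tuple n A.
Proof. by have [mu <-] := lebesgue_tuple_measure n; exact: measure_ge0. Qed.

Let lebesgue_tuple_sigma_additive n : semi_sigma_additive (lebesgue_tuple n).
Proof.
have [mu <-] := lebesgue_tuple_measure n; exact: measure_semi_sigma_additive.
Qed.

HB.instance Definition _ n := isMeasure.Build _ _ _ (lebesgue_tuple n)
  (@lebesgue_tuple0 n) (@lebesgue_tuple_ge0 n) (@lebesgue_tuple_sigma_additive n).

Let lebesgue_tuple_sigma_finite n : sigma_finite setT (lebesgue_tuple n).
Proof. by have [mu <-] := lebesgue_tuple_measure n; exact: sigma_finiteT. Qed.

HB.instance Definition _ n := Measure_isSigmaFinite.Build _ _ _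
  (lebesgue_tuple n) (@lebesgue_tuple_sigma_finite n).

Lemma lebesgue_tuple_box n (A : 'I_n -> set T) :
  (forall i, measurable (A i)) ->
  lebesgue_tuple n [set t | forall i, A i (tnth t i)] =
  \prod_(i < n) lebesgue_measure (A i).
Proof.
elim: n A => [|n IHn] A mA.
  rewrite big_ord0 /= diracE mem_set//=; by case.
have mB : measurable [set t : n.-tuple T | forall i, A (lift ord0 i) (tnth t i)].
  rewrite (_ : [set t | _] = \bigcap_(i in [set: 'I_n])
    ((@tnth _ T ^~ i) @^-1` A (lift ord0 i))); last first.
    by apply/seteqP; split => t /= h i; [move=> _|]; exact: h.
  apply: fin_bigcap_measurable => [|i _]; first exact: finite_finset.
  by rewrite -[X in measurable X]setTI; exact: measurable_tnth.
rewrite big_ord_recl -IHn => [|i]; last exact: mA.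
rewrite -product_measure1E//= /pushforward; congr (product_measure1 _ _ _).
apply/seteqP; split => -[x t] /=.
  move=> h; split; first exact: (h ord0).
  by move=> i; have := h (lift ord0 i); rewrite tnthS.
move=> [h0 h] i; case: (unliftP ord0 i) => [j|] ->; last exact: h0.
by rewrite tnthS; exact: h.
Qed.

End lebesgue_tuple.
Arguments lebesgue_tuple {R} n.

Section definitions.
Context {R : realType}.

(* Lebesgue volume; meaningful for Borel sets A, in particular compact ones. *)
Definition volume n (A : set 'rV[R]_n) : \bar R :=
  lebesgue_tuple n [set t | A (\row_i tnth t i)].

Definition origin_symmetric n (K : set 'rV[R]_n) := forall x, K x -> K (- x).

Definition convex_body n (K : set 'rV[R]_n) :=
  [/\ convex_set K, compact K & K° !=set0].

(* L_p is the real space L_p([0, 1]). *)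
Definition lebesgue01 : set (measurableTypeR R) -> \bar R :=
  mrestr lebesgue_measure (measurable_itv `[0%R, 1%R]).

HB.instance Definition _ := Measure.on lebesgue01.

Local Notation mu := lebesgue01.
Local Notation F := (measurableTypeR R -> R).

(* Elements of L_p are represented by functions: a linear subspace of L_p is a
   linear space of p-integrable functions that is saturated for almost-everywhere
   equality, and linear (in)dependence is understood almost everywhere. *)
Definition Lp_subspace (p : R) (E : set F) :=
  [/\ E `<=` [set f | f \in Lfun mu p%:E],
      E 0,
      forall a f g, E f -> E g -> E (a *: f + g) &
      forall f g, E f -> g \in Lfun mu p%:E -> f = g %[ae mu] -> E g].

Definition Lp_dimension n (E : set F) :=
  exists b : 'I_n -> F,
    [/\ forall i, E (b i),
        forall c : 'I_n -> R,
          (\sum_i c i *: b i : F) = 0 %[ae mu] -> forall i, c i = 0 &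
        forall f, E f ->
          exists c : 'I_n -> R, f = \sum_i c i *: b i %[ae mu]].

Definition Lp_unit_ball (p : R) (E : set F) : set F :=
  [set f | E f /\ ('N[mu]_p%:E [EFin \o f] <= 1)%E].

(* A linear map out of the subspace E of L_p (well defined on classes modulo
   almost-everywhere equality); only its values on E matter. *)
Definition Lp_linear n (E : set F) (T : F -> 'rV[R]_n) :=
  (forall a f g, E f -> E g -> T (a *: f + g) = a *: T f + T g) /\
  (forall f g, E f -> E g -> f = g %[ae mu] -> T f = T g).

Definition Lpn (p : R) n : set (set 'rV[R]_n) :=
  [set D | [/\ origin_symmetric D, convex_body D &
    exists E (T : F -> 'rV[R]_n),
      [/\ Lp_subspace p E, Lp_dimension n E, Lp_linear E T &
          D = T @` Lp_unit_ball p E]]].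

Definition d_ovr n (K : set 'rV[R]_n) (p : R) : \bar R :=
  ereal_inf [set ((volume D / volume K) `^ n%:R^-1)%E |
    D in [set D | Lpn p D /\ K `<=` D]].

End definitions.

(* Main.v *)
(* Let [v_1, ..., v_m], with [m = 448 n], be sign vectors such that the average of
   [|<v_i, a>|] is at least [|a| / 29] for all [a] (Kashin's phenomenon; a random
   choice works), and let [L] be the convex hull of the [v_i] and [- v_i]. On the
   one hand [L] is covered by [2 ^ (1370 n)] cubes of side [n^(-1/2)]. On the other
   hand the norm of a body [D] of [L_p^n] is given by
   [|x|_D ^ p = int |<x, f(t)>| ^ p dt] for some [f : [0, 1] -> R^n]. If [L] is
   contained in [D] then [1 >= avg_i |v_i|_D ^ p >= int (|f(t)| / 29) ^ p dt], while by
   Khinchine's inequality the average of [|x|_D ^ p] over the cube [-h, h]^n is at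
   most [int (C sqrt p h |f(t)|) ^ p dt]. So for [h] of order [1 / sqrt p] at least half
   of that cube lies in [D], and [|D| >= h ^ n]. *)
Require Import Defs.
From HB Require Import structures.
From mathcomp Require Import all_boot all_order all_algebra.
From mathcomp Require Import all_classical all_reals all_analysis.
From mathcomp Require Import measurable_realfun.
From mathcomp Require Import ring lra.

Import Order.TTheory GRing.Theory Num.Theory.
Import numFieldNormedType.Exports.

Local Open Scope classical_set_scope.
Local Open Scope ring_scope.

(** * Counting and rounding integer points *)

(** Give [z] the weight [2 ^ (- \sum_i (z i).2)]. A counted point weighs at least [2 ^ (- S)], while
    the total weight is a product over the coordinates whose factors are at most 4: two signs times
    a geometric series. *)
Lemma card_l1_ball (I : finType) N S :
  (#|[set z : {ffun I -> bool * 'I_N} | (\sum_i (z i).2 <= S)%N]%SET|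
    <= 4 ^ #|I| * 2 ^ S)%N.
Proof.
rewrite -(ler_nat rat) natrM !natrX -sum1_card natr_sum.
have half2 k : \sum_(i < k) (2^-1 : rat) ^+ i <= 2.
  suff -> : \sum_(i < k) (2^-1 : rat) ^+ i = 2 - 2 * 2^-1 ^+ k.
    by rewrite gerBl mulr_ge0.
  elim: k => [|k IHk]; first by rewrite big_ord0 expr0; lra.
  by rewrite big_ord_recr /= IHk exprS; field.
apply: (@le_trans _ _
    (\sum_(z : {ffun I -> bool * 'I_N}) 2 ^+ S * \prod_i 2^-1 ^+ (z i).2)).
  rewrite [leRHS](bigID (mem [set z : {ffun I -> bool * 'I_N} |
    (\sum_i (z i).2 <= S)%N]%SET)) /= -[leLHS]addr0 lerD //.
    apply: ler_sum => z; rewrite inE => zS.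
    rewrite -expr_sum exprVn ler_pdivlMr ?exprn_gt0// mul1r.
    by rewrite ler_weXn2l// ler1n.
  by apply: sumr_ge0 => z _; rewrite mulr_ge0 ?prodr_ge0// => i _; rewrite exprn_ge0.
rewrite -mulr_sumr mulrC ler_wpM2r ?exprn_ge0//.
rewrite -(bigA_distr_bigA (fun _ (c : bool * 'I_N) => (2^-1 : rat) ^+ c.2)).
rewrite prodr_const lerXn2r ?nnegrE//.
  by apply: sumr_ge0 => i _; rewrite exprn_ge0.
rewrite -(pair_bigA _ (fun (b : bool) (k : 'I_N) => (2^-1 : rat) ^+ k)) /=.
by rewrite big_bool /=; have := half2 N; lra.
Qed.

Section euclidean.
Context {R : realType}.

(** Cauchy-Schwarz by Lagrange's identity: the difference of the two sides is half a sum of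
    squares. *)
Lemma sqr_sum_mul_le (I : finType) (a b : I -> R) :
  (\sum_i a i * b i) ^+ 2 <= (\sum_i a i ^+ 2) * (\sum_i b i ^+ 2).
Proof.
rewrite -subr_ge0.
have -> : (\sum_i a i ^+ 2) * (\sum_i b i ^+ 2) - (\sum_i a i * b i) ^+ 2 =
    2^-1 * \sum_i \sum_j (a i * b j - a j * b i) ^+ 2.
  have E i j : (a i * b j - a j * b i) ^+ 2 = a i ^+ 2 * b j ^+ 2 +
     a j ^+ 2 * b i ^+ 2 - 2 * ((a i * b i) * (a j * b j)) by ring.
  under [X in 2^-1 * X]eq_bigr => i _ do under eq_bigr => j _ do rewrite E.
  under [X in 2^-1 * X]eq_bigr => i _ do
    rewrite sumrB big_split/= -!mulr_sumr -mulr_suml.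
  rewrite sumrB big_split/= -!mulr_suml -!mulr_sumr -mulr_suml.
  by rewrite !expr2; field.
by rewrite mulr_ge0// sumr_ge0// => i _; rewrite sumr_ge0// => j _; rewrite sqr_ge0.
Qed.

Lemma sqr_sum_norm_le (I : finType) (a : I -> R) :
  (\sum_i `|a i|) ^+ 2 <= #|I|%:R * \sum_i a i ^+ 2.
Proof.
have := sqr_sum_mul_le _ (fun=> 1) (fun i => `|a i|).
under eq_bigr do rewrite mul1r; rewrite expr1n sumr_const.
by under [X in _ * X]eq_bigr do rewrite real_normK ?num_real//.
Qed.

(* The last coordinate is rounded up or down, whichever makes the cross term
   with the error accumulated so far nonpositive. *)
Lemma round_sqr_sum (m k : nat) (w : 'I_m -> 'I_k -> R) (N : R) (t : 'I_m -> R) :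
  (forall i, \sum_j w i j ^+ 2 <= N) ->
  exists z : 'I_m -> int, (forall i, `|t i - (z i)%:~R| <= 1) /\
    \sum_j (\sum_i (t i - (z i)%:~R) * w i j) ^+ 2 <= m%:R * N.
Proof.
elim: m w t => [|m IHm] w t wN.
  exists (fun=> 0); split; first by case.
  by rewrite mul0r big1// => j _; rewrite big_ord0 expr0n.
have [z [z1 zN]] := IHm (fun i => w (lift ord_max i)) (fun i => t (lift ord_max i))
  (fun i => wN _).
pose s j := \sum_i (t (lift ord_max i) - (z i)%:~R) * w (lift ord_max i) j.
pose B := \sum_j s j * w ord_max j.
have [d [d1 dB]] : exists d : int, `|t ord_max - d%:~R| <= 1 /\
    (t ord_max - d%:~R) * B <= 0.
  have := floor_itv (t ord_max).
  set f := Num.floor _ => /andP[f1 f2].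
  have f2' : t ord_max < f%:~R + 1 by move: f2; rewrite intrD.
  have [B0|B0] := lerP B 0.
    exists f; split; first by rewrite ger0_norm; lra.
    by rewrite mulr_ge0_le0// subr_ge0.
  exists (f + 1); rewrite intrD; split; first by rewrite ler0_norm; lra.
  by rewrite mulr_le0_ge0// ?ltW//; lra.
exists (fun i => if unlift ord_max i is Some j then z j else d); split=> [i|].
  by case: unliftP => [j ->|->].
have E j : (\sum_i (t i - (if unlift ord_max i is Some j then z j else d)%:~R) * w i j)
    = s j + (t ord_max - d%:~R) * w ord_max j.
  rewrite (bigD1_ord ord_max)//= unlift_none addrC; congr (_ + _).
  by apply: eq_bigr => i _; rewrite liftK.
under eq_bigr do rewrite E sqrrD.
rewrite !big_split/= mulrSr mulrDl mul1r.
have dN : \sum_j ((t ord_max - d%:~R) * w ord_max j) ^+ 2 <= N.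
  under eq_bigr do rewrite exprMn.
  rewrite -mulr_sumr -[leRHS]mul1r ler_pM ?sqr_ge0 ?sumr_ge0// => [j _|].
    exact: sqr_ge0.
  by rewrite -real_normK ?num_real// exprn_ile1.
have sB : \sum_j s j * ((t ord_max - d%:~R) * w ord_max j) <= 0.
  by under eq_bigr do rewrite mulrCA; rewrite -mulr_sumr.
by rewrite -addrA (lerD zN)// -[leRHS]add0r lerD// -[leRHS]add0r lerD.
Qed.

End euclidean.

(** * Rademacher sums *)

Section rademacher.
Context {R : realType} {I : finType}.

Let flip (j : I) (v : {ffun I -> bool}) := [ffun i => v i (+) (i == j)].

Let flipK j : involutive (flip j).
Proof. by move=> v; apply/ffunP => i; rewrite !ffunE -addbA addbb addbF. Qed.

Let rsum (r : seq I) (a : I -> R) (v : {ffun I -> bool}) : R :=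
  \sum_(j <- r) (-1) ^+ v j * a j.

(** Flipping the [j]-th sign permutes the sign vectors and leaves [rsum r a] unchanged, so the sum
    equals its own opposite. *)
Let sum_rsum_exp_sign (r : seq I) a j k : j \notin r ->
  \sum_v (-1) ^+ (v : {ffun I -> bool}) j * rsum r a v ^+ k = 0.
Proof.
move=> jr; set S := LHS; suff : S + S = 0 by lra.
rewrite /S {1}(reindex_inj (inv_inj (flipK j))) -big_split big1//= => v _.
rewrite ffunE eqxx addbT signrN mulNr; suff -> : rsum r a (flip j v) = rsum r a v.
  by rewrite addNr.
apply: eq_big_seq => i ir; rewrite ffunE.
by rewrite (_ : i == j = false) ?addbF//; apply/eqP => ij; rewrite -ij ir in jr.
Qed.

Let sum_rsum_sign (r : seq I) a j : j \notin r ->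
  \sum_v (-1) ^+ (v : {ffun I -> bool}) j * rsum r a v = 0.
Proof. exact: (sum_rsum_exp_sign r a j 1). Qed.

Let sum_rsum2 r a : uniq r ->
  \sum_v rsum r a v ^+ 2 = #|{ffun I -> bool}|%:R * \sum_(j <- r) a j ^+ 2.
Proof.
elim: r => [_|j r IHr /= /andP[jr ur]].
  by rewrite big_nil mulr0 big1// => v _; rewrite /rsum big_nil expr0n.
rewrite big_cons mulrDr -(IHr ur).
have E v : rsum (j :: r) a v ^+ 2 =
    a j ^+ 2 + (2 * a j * ((-1) ^+ v j * rsum r a v) + rsum r a v ^+ 2).
  by rewrite /rsum big_cons -/(rsum r a v) sqrrD exprMn sqrr_sign; ring.
under eq_bigr do rewrite E.
rewrite !big_split/= sumr_const -mulr_sumr sum_rsum_sign// mulr0 add0r.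
by rewrite mulr_natl.
Qed.

(** Induction on [r]: the odd powers of the new sign average out, and
    [a^4 + 6 a^2 s + 3 s^2 <= 3 (a^2 + s)^2] where [s] is the sum of the earlier squares. *)
Let sum_rsum4 r a : uniq r ->
  \sum_v rsum r a v ^+ 4 <=
  3 * #|{ffun I -> bool}|%:R * (\sum_(j <- r) a j ^+ 2) ^+ 2.
Proof.
elim: r => [_|j r IHr /= /andP[jr ur]].
  by rewrite big_nil expr0n mulr0 big1// => v _; rewrite /rsum big_nil expr0n.
rewrite big_cons.
have E v : rsum (j :: r) a v ^+ 4 = a j ^+ 4 +
    (4 * a j ^+ 3 * ((-1) ^+ v j * rsum r a v) +
    (6 * a j ^+ 2 * rsum r a v ^+ 2 +
    (4 * a j * ((-1) ^+ v j * rsum r a v ^+ 3) + rsum r a v ^+ 4))).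
  rewrite /rsum big_cons -/(rsum r a v).
  by case: (v j); rewrite ?expr0 ?expr1; ring.
under eq_bigr do rewrite E.
rewrite !big_split/= sumr_const -!mulr_sumr sum_rsum_sign// sum_rsum_exp_sign//.
rewrite sum_rsum2// !mulr0 !add0r.
rewrite -[X in X + _]mulr_natl.
have := IHr ur; set N := #|_|%:R; set s := \sum_(j <- r) _ => H4.
have N0 : 0 <= N by rewrite ler0n.
have : 0 <= N * a j ^+ 4 by rewrite mulr_ge0// exprn_even_ge0.
move: H4; set A := \sum_v _; nra.
Qed.

(** A Chernoff factor. A product of [m] such exponentials is at least 1 as soon as the absolute
    values add up to at most [m / 10]; for independent sign vectors this event thus has probability
    at most [(19 / 20) ^ m]. *)
Lemma sum_expR_rademacher (a : I -> R) : \sum_j a j ^+ 2 = 1 ->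
  expR 40^-1 * \sum_(v : {ffun I -> bool})
    expR (- (`|\sum_j (-1) ^+ v j * a j| / 4)) <=
  19 / 20 * #|{ffun I -> bool}|%:R.
Proof.
move=> a1; set N := #|_|%:R.
have e40 : expR 40^-1 <= 40 / 39 :> R.
  rewrite -[40^-1 in leLHS]opprK expRN.
  have := expR_ge1Dx (- 40^-1 : R) => h.
  rewrite -[leRHS]invrK lef_pV2 ?posrE ?expR_gt0//; lra.
(* With [u = y / 4], [exp (- u) <= 1 / (1 + u) <= 1 - u + u^2]; the quartic exceeds this quadratic
   by [y (y - 3/2)^2 (y + 3) / 27]. *)
have pt (y : R) : 0 <= y -> expR (- (y / 4)) <=
    1 - 3 / 16 * y ^+ 2 + y ^+ 4 / 27.
  move=> y0; apply: (@le_trans _ _ (1 - y / 4 + (y / 4) ^+ 2)).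
    have y1 : 0 < 1 + y / 4 by lra.
    apply: (@le_trans _ _ (1 + y / 4)^-1).
      rewrite expRN lef_pV2 ?posrE ?expR_gt0//; exact: expR_ge1Dx.
    rewrite -[leLHS]mul1r ler_pdivrMr//.
    rewrite [leRHS](_ : _ = 1 + (y / 4) ^+ 3); last by field.
    by rewrite lerDl exprn_ge0// divr_ge0.
  have : 0 <= y * (y - 3 / 2) ^+ 2 * (y + 3) / 27.
    apply: divr_ge0 => //; apply: mulr_ge0; last by lra.
    by apply: mulr_ge0 => //; exact: sqr_ge0.
  by rewrite -subr_ge0 => h; rewrite -subr_ge0; lra.
(* The second moment is 1 and the fourth is at most 3, and [133 / 144 = 1 - 3 / 16 + 3 / 27]. *)
have : \sum_(v : {ffun I -> bool}) expR (- (`|\sum_j (-1) ^+ v j * a j| / 4))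
    <= 133 / 144 * N.
  apply: (@le_trans _ _ (\sum_(v : {ffun I -> bool})
      (1 - 3 / 16 * (\sum_j (-1) ^+ v j * a j) ^+ 2 +
       (\sum_j (-1) ^+ v j * a j) ^+ 4 / 27))).
    apply: ler_sum => v _.
    rewrite (le_trans (pt _ (normr_ge0 _)))// -!normrX !ger0_norm//.
      by rewrite exprn_even_ge0.
    by rewrite exprn_even_ge0.
  rewrite !big_split/= sumrN -mulr_sumr -mulr_suml sumr_const -/N.
  have := sum_rsum2 (index_enum I) a (index_enum_uniq I).
  have := sum_rsum4 (index_enum I) a (index_enum_uniq I).
  rewrite /rsum a1 => h4 ->; move: h4; rewrite -/N; set A := \sum_v _; lra.
set A := \sum_v _ => hA; apply: (@le_trans _ _ (40 / 39 * (133 / 144 * N))).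
  by rewrite ler_pM ?expR_ge0// sumr_ge0// => v _; rewrite expR_ge0.
by have : 0 <= N by []; lra.
Qed.

End rademacher.

(** * Sign vectors with large linear forms *)

Section kashin.
Context {R : realType}.

(** Coding integers by a sign and a bounded absolute value puts integer points in a finite type,
    where [card_l1_ball] counts them. Zero has two codes, which is harmless in an upper bound. *)
Definition signed_val {N} (c : bool * 'I_N) : R := (-1) ^+ c.1 * (c.2)%:R.

Lemma signed_val_code (I : finType) (S : nat) (z : I -> int) :
  \sum_i `|z i|%:~R <= S%:R :> R ->
  exists2 c : {ffun I -> bool * 'I_S.+1},
    (\sum_i (c i).2 <= S)%N & forall i, signed_val (c i) = (z i)%:~R.
Proof.
move=> zS.
have zE : \sum_i `|z i|%:~R = (\sum_i `|z i|%N)%:R :> R.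
  by rewrite natr_sum; apply: eq_bigr => i _; rewrite -abszE.
have {zE}zS : (\sum_i `|z i| <= S)%N by rewrite -(ler_nat R) -zE.
have E i : (inord `|z i|%N : 'I_S.+1) = `|z i|%N :> nat.
  by rewrite inordK// ltnS (leq_trans _ zS)// (bigD1 i)//= leq_addr.
exists [ffun i => (z i < 0, inord `|z i|%N)].
  by under eq_bigr do rewrite ffunE /= E.
move=> i; rewrite ffunE /signed_val /= E [in RHS](intEsign (z i)) rmorphM.
by rewrite rmorph_sign.
Qed.

(* Union bound over the integer points [z] with [\sum_j |z j| <= 30 n]; a vector
   of norm [29 * sqrt n] is replaced by such a point using [round_sqr_sum]. *)
Lemma exists_sign_vectors (n : nat) : (0 < n)%N ->
  exists V : 'I_(448 * n) -> 'I_n -> R, (forall i j, V i j ^+ 2 = 1) /\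
    forall a : 'I_n -> R, (448 * n)%:R * Num.sqrt (\sum_j a j ^+ 2) <=
      29 * \sum_i `|\sum_j V i j * a j|.
Proof.
move=> n0; set m := (448 * n)%N.
pose W (v : {ffun 'I_m -> {ffun 'I_n -> bool}}) i j : R := (-1) ^+ v i j.
apply/not_existsP => noV.
have {}noV v : exists a : 'I_n -> R, 29 * \sum_i `|\sum_j W v i j * a j| <
    m%:R * Num.sqrt (\sum_j a j ^+ 2).
  apply/not_existsP => h; apply: (noV (W v)); split=> [i j|a]; first exact: sqrr_sign.
  by rewrite leNgt; apply/negP; exact: h.
pose Z := [set c : {ffun 'I_n -> bool * 'I_(30 * n).+1} |
  (\sum_j (c j).2 <= 30 * n)%N]%SET.
pose r (c : {ffun 'I_n -> bool * 'I_(30 * n).+1}) : R :=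
  Num.sqrt (\sum_j signed_val (c j) ^+ 2).
have bad v : exists2 c, c \in Z & 0 < r c /\
    \sum_i `|\sum_j W v i j * signed_val (c j)| <= m%:R / 10 * r c.
  have [a aV] := noV v; set q := Num.sqrt _ in aV.
  have n0R : 0 < n%:R :> R by rewrite ltr0n.
  have sn0 : 0 < Num.sqrt n%:R :> R by rewrite sqrtr_gt0.
  have snE : Num.sqrt n%:R ^+ 2 = n%:R :> R by rewrite sqr_sqrtr// ltW.
  have q0 : 0 < q.
    rewrite lt_def sqrtr_ge0 andbT; apply/eqP => q0; move: aV.
    by rewrite q0 mulr0 ltNge mulr_ge0// sumr_ge0.
  (* At this length the factor 29 cancels: the absolute values of the forms at [t] add up to at most
     [m * sqrt n]. *)
  pose t j := 29 * Num.sqrt n%:R / q * a j.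
  have t2 : \sum_j t j ^+ 2 = 841 * n%:R.
    under eq_bigr do rewrite exprMn.
    rewrite -mulr_sumr !exprMn snE exprVn sqr_sqrtr; last first.
      by rewrite sumr_ge0// => j _; rewrite sqr_ge0.
    have : \sum_j a j ^+ 2 != 0 by rewrite gt_eqF// -sqrtr_gt0.
    by move=> ?; field.
  have tV : \sum_i `|\sum_j W v i j * t j| <= m%:R * Num.sqrt n%:R.
    have -> : \sum_i `|\sum_j W v i j * t j| =
        Num.sqrt n%:R / q * (29 * \sum_i `|\sum_j W v i j * a j|).
      rewrite mulrA mulr_sumr; apply: eq_bigr => i _.
      rewrite -[X in X * `|_|]ger0_norm ?mulr_ge0 ?invr_ge0 ?ltW// -normrM.
      by congr (`|_|); rewrite mulr_sumr; apply: eq_bigr => j _; rewrite /t; ring.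
    have -> : m%:R * Num.sqrt n%:R = Num.sqrt n%:R / q * (m%:R * q).
      by field; rewrite gt_eqF.
    by rewrite ler_wpM2l ?divr_ge0// ltW.
  (* The matrix is transposed: the [n] coordinates of [t] are rounded against the columns of [W v],
     of squared length [m]. *)
  have [] := round_sqr_sum n m (fun j i => W v i j) m%:R t.
    move=> j; under eq_bigr do rewrite sqrr_sign.
    by rewrite sumr_const card_ord.
  move=> z [z1 zV].
  (* By Cauchy-Schwarz [t] has l_1 norm at most [29 n], and rounding adds at most 1 per
     coordinate. *)
  have zS : \sum_j `|z j|%:~R <= (30 * n)%:R :> R.
    have tS : \sum_j `|t j| <= 29 * n%:R.
      rewrite -ler_sqr ?nnegrE ?mulr_ge0 ?sumr_ge0// (le_trans (sqr_sum_norm_le _ _))//.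
      by rewrite card_ord t2 !expr2; lra.
    have : \sum_j `|z j|%:~R <= \sum_j (`|t j| + 1) :> R.
      apply: ler_sum => j _; rewrite intr_norm.
      rewrite -[(z j)%:~R](subKr (t j)) (le_trans (ler_normB _ _))// lerD//.
    rewrite big_split/= sumr_const card_ord => /le_trans; apply.
    by rewrite natrM; lra.
  have [c cS cz] := signed_val_code _ _ z zS.
  have rc : 20 * Num.sqrt n%:R <= r c.
    rewrite -ler_sqr ?nnegrE ?mulr_ge0 ?sqrtr_ge0// exprMn snE sqr_sqrtr; last first.
      by rewrite sumr_ge0// => j _; rewrite sqr_ge0.
    (* The left-hand side is [(841 / 2 - 1) n], which exceeds [400 n]. *)
    have : \sum_j (t j ^+ 2 / 2 - 1) <= \sum_j signed_val (c j) ^+ 2.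
      apply: ler_sum => j _; rewrite cz.
      move: (z1 j) => /ler_normlP[]; set y := _%:~R; move: (t j) => x.
      by have := sqr_ge0 (x - 2 * y); nra.
    by rewrite sumrB -mulr_suml t2 sumr_const card_ord; lra.
  exists c; first by rewrite inE.
  split; first by rewrite (lt_le_trans _ rc)// mulr_gt0.
  have dV : \sum_i `|\sum_j (t j - (z j)%:~R) * W v i j| <= m%:R * Num.sqrt n%:R.
    rewrite -ler_sqr ?nnegrE ?mulr_ge0 ?sumr_ge0//.
    rewrite (le_trans (sqr_sum_norm_le _ _))// card_ord exprMn snE.
    have -> : m%:R ^+ 2 * n%:R = m%:R * (n%:R * m%:R) :> R by ring.
    by rewrite ler_wpM2l.
  (* One [m * sqrt n] comes from [t], the other from the rounding error, and
     [2 * sqrt n <= r c / 10] by [rc]. *)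
  apply: (@le_trans _ _ (2 * (m%:R * Num.sqrt n%:R))).
    rewrite mulr_natl mulr2n; apply: le_trans (lerD tV dV).
    rewrite -big_split/=; apply: ler_sum => i _.
    have -> : \sum_j W v i j * signed_val (c j) = (\sum_j W v i j * t j) -
        \sum_j (t j - (z j)%:~R) * W v i j.
      by rewrite -sumrB; apply: eq_bigr => j _; rewrite cz; ring.
    exact: ler_normB.
  by rewrite -mulrA mulrCA ler_wpM2l//; lra.
(* The factor of [sum_expR_rademacher] in the direction of [c]; its product over the vectors of a
   family is at least 1 when [c] is bad for that family. *)
pose F (v : {ffun 'I_n -> bool}) (c : {ffun 'I_n -> bool * 'I_(30 * n).+1}) : R :=
  expR 40^-1 * expR (- (`|\sum_j (-1) ^+ v j * (signed_val (c j) / r c)| / 4)).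
have one (v : {ffun 'I_m -> {ffun 'I_n -> bool}}) :
    1 <= \sum_(c in Z | 0 < r c) \prod_i F (v i) c.
  have [c cZ [r0 cF]] := bad v.
  rewrite (bigD1 c)/= ?cZ// -[leLHS]addr0 lerD//.
    rewrite big_split/= prodr_const card_ord -expRM_natl -expR_sum -expRD.
    rewrite -[leLHS]expR0 ler_expR sumrN -mulr_suml.
    have -> : \sum_i `|\sum_j (-1) ^+ v i j * (signed_val (c j) / r c)| =
        (\sum_i `|\sum_j W v i j * signed_val (c j)|) / r c.
      rewrite mulr_suml; apply: eq_bigr => i _.
      under eq_bigr do rewrite mulrA.
      by rewrite -mulr_suml normrM (@ger0_norm _ (r c)^-1)// invr_ge0 ltW.
    by move: cF; rewrite -ler_pdivrMr//; set A := (_ / r c); lra.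
  rewrite sumr_ge0// => c' _; rewrite prodr_ge0// => i _.
  by rewrite mulr_ge0 ?expR_ge0.
(* Sum [one] over all families and exchange the sums: for fixed [c] the inner sum is an [m]-th
   power. *)
have : \sum_(v : {ffun 'I_m -> {ffun 'I_n -> bool}}) (1 : R) <=
    \sum_(c in Z | 0 < r c) (19 / 20 * #|{ffun 'I_n -> bool}|%:R) ^+ m.
  apply: (le_trans (ler_sum _ (fun v _ => one v))).
  rewrite exchange_big/= ler_sum// => c /andP[_ rc0].
  rewrite -(bigA_distr_bigA (fun _ v => F v c)) prodr_const card_ord lerXn2r ?nnegrE//.
    by rewrite sumr_ge0// => v _; rewrite mulr_ge0 ?expR_ge0.
  rewrite -mulr_sumr; apply: sum_expR_rademacher.
  under eq_bigr do rewrite exprMn.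
  rewrite -mulr_suml exprVn sqr_sqrtr; first by rewrite mulfV// gt_eqF// -sqrtr_gt0.
  by rewrite sumr_ge0// => j _; rewrite sqr_ge0.
rewrite !sumr_const card_ffun card_ord exprMn natrX => le1.
have : (#|{ffun 'I_n -> bool}|%:R : R) ^+ m <=
    (4 ^ n * 2 ^ (30 * n))%N%:R * (19 / 20) ^+ m * #|{ffun 'I_n -> bool}|%:R ^+ m.
  rewrite (le_trans le1)// -[leLHS]mulr_natl -[leRHS]mulrA.
  rewrite ler_wpM2r// ?mulr_ge0// ?exprn_ge0//.
  rewrite ler_nat; have := card_l1_ball 'I_n (30 * n).+1 (30 * n).
  rewrite card_ord; apply: leq_trans; apply: subset_leq_card.
  by apply/fintype.subsetP => c /andP[].
rewrite -[leLHS]mul1r ler_pM2r ?exprn_gt0 ?ltr0n ?card_ffun ?expn_gt0 ?card_bool//.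
rewrite leNgt => /negP; apply.
(* Origin of 448: there are at most [2 ^ (32 n)] points, and [448 = 14 * 32]. *)
have half : 2 * (19 / 20) ^+ 14 < 1 :> R by lra.
have q0 : 0 <= 19 / 20 :> R by [].
have -> : (4 ^ n * 2 ^ (30 * n) = 2 ^ (32 * n))%N.
  by rewrite -(expnM 2 2) -expnD -mulnDl.
have -> : m = (14 * (32 * n))%N by rewrite /m mulnA.
have n32 : (32 * n != 0)%N by rewrite -lt0n muln_gt0.
by rewrite natrX (exprM (19 / 20)) -exprMn exprn_ilt1 ?mulr_ge0 ?exprn_ge0.
Qed.

End kashin.

(** * Moments of linear forms on a grid *)

Section powers.
Context {R : realType}.

(** Raise [y / p <= exp (y / p)] to the power [p]. This converts exponential moments into [p]-th
    moments. *)
Lemma powR_le_expR (p y : R) : 1 <= p -> 0 <= y -> y `^ p <= p `^ p * expR y.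
Proof.
move=> p1 y0; have p0 : 0 < p by exact: lt_le_trans p1.
have yp : y <= p * expR (y / p).
  rewrite -ler_pdivrMl// mulrC (le_trans _ (expR_ge1Dx _))// lerDr//.
apply: (@le_trans _ _ ((p * expR (y / p)) `^ p)).
  by rewrite ge0_ler_powR ?nnegrE ?mulr_ge0 ?expR_ge0// ltW.
by rewrite powRM ?expR_ge0 ?(ltW p0)// -expRM divfK// gt_eqF.
Qed.

(** Bernoulli's inequality, from Young's inequality applied to [x] and 1; [p = 1] has no finite
    conjugate exponent and is treated apart. *)
Lemma powR_ge_tangent (p x : R) : 1 <= p -> 0 <= x -> 1 + p * (x - 1) <= x `^ p.
Proof.
rewrite le_eqVlt => /predU1P[<-|p1] x0; first by rewrite powRr1// mul1r addrC subrK.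
have p0 : 0 < p by exact: lt_trans p1.
have q0 : 0 < p / (p - 1) by rewrite divr_gt0// subr_gt0.
have pq : p^-1 + (p / (p - 1))^-1 = 1.
  by rewrite invf_div; field; rewrite ?gt_eqF.
have := conjugate_powR x0 (@ler01 R) p0 q0 pq.
rewrite powR1 mulr1 mul1r -(ler_pM2l p0) mulrDr invf_div.
rewrite (mulrCA p (_ `^ _)) mulfV ?gt_eqF// mulr1 mulrCA mulfV ?gt_eqF// mulr1; lra.
Qed.

(** Jensen's inequality: sum the tangent inequalities at the mean [mu], where the linear terms
    cancel. *)
Lemma powR_mean_le (I : finType) (b : I -> R) (p : R) : 1 <= p ->
  (forall i, 0 <= b i) -> (0 < #|I|)%N ->
  #|I|%:R * ((\sum_i b i) / #|I|%:R) `^ p <= \sum_i b i `^ p.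
Proof.
move=> p1 b0 I0; have p0 : 0 < p by exact: lt_le_trans p1.
have I0R : 0 < #|I|%:R :> R by rewrite ltr0n.
set mu := _ / _; have mu0 : 0 <= mu by rewrite divr_ge0 ?sumr_ge0.
have muE : \sum_i b i = mu * #|I|%:R by rewrite divfK// gt_eqF.
clearbody mu; move: mu0; rewrite le_eqVlt => /predU1P[<-|mu0].
  by rewrite powR0 ?gt_eqF// mulr0 sumr_ge0// => i _; exact: powR_ge0.
have : \sum_i (mu `^ p * (1 + p * (b i / mu - 1))) <= \sum_i b i `^ p.
  apply: ler_sum => i _; rewrite -[b i in leRHS](divfK (lt0r_neq0 mu0)).
  rewrite powRM ?divr_ge0 ?(ltW mu0)// mulrC ler_wpM2r ?powR_ge0//.
  by rewrite powR_ge_tangent// divr_ge0// ltW.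
apply: le_trans; rewrite -mulr_sumr big_split/= -mulr_sumr big_split/= -mulr_suml.
rewrite sumrN !sumr_const -[1 *+ _]/(#|I|%:R) muE.
by rewrite mulrAC divff ?gt_eqF// mul1r subrr mulr0 addr0 mulrC.
Qed.

(* [cosh (2 v) <= cosh v ^ 4] reduces the claim to small [u]. *)
Lemma cosh_le_expR (u : R) : expR u + expR (- u) <= 2 * expR (2 * u ^+ 2).
Proof.
have small (v : R) : v ^+ 2 <= 4^-1 -> expR v + expR (- v) <= 2 * expR (2 * v ^+ 2).
  move=> v2; have [v1 v1'] : v < 1 /\ - 1 < v by split; nra.
  have h1 : expR v <= (1 - v)^-1.
    rewrite -[v in leLHS]opprK expRN lef_pV2 ?posrE ?expR_gt0 ?subr_gt0//.
    exact: expR_ge1Dx.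
  have h2 : expR (- v) <= (1 + v)^-1.
    rewrite expRN lef_pV2 ?posrE ?expR_gt0//; last by lra.
    exact: expR_ge1Dx.
  apply: (@le_trans _ _ (2 * (1 + 2 * v ^+ 2))); last first.
    by rewrite ler_wpM2l// expR_ge1Dx.
  apply: (le_trans (lerD h1 h2)).
  have -> : (1 - v)^-1 + (1 + v)^-1 = 2 / (1 - v ^+ 2).
    by field; rewrite !gt_eqF//; nra.
  rewrite ler_pdivrMr; last by lra.
  by have := sqr_ge0 v; nra.
(* With [w = exp (2 v^2)], squaring the hypothesis bounds the new sum by [4 w^2 - 2], and
   [4 w^2 - 2 <= 2 w^4]. *)
have double (v : R) : expR v + expR (- v) <= 2 * expR (2 * v ^+ 2) ->
    expR (2 * v) + expR (- (2 * v)) <= 2 * expR (2 * (2 * v) ^+ 2).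
  have -> : 2 * (2 * v) ^+ 2 = 4 * (2 * v ^+ 2) by ring.
  rewrite -mulrN !(expRM_natl 2 v) !(expRM_natl 2 (- v)) (expRM_natl 4) expRN.
  have := expR_gt0 v; move: (expR v) => e e0.
  have ee : e * e^-1 = 1 by rewrite divff// gt_eqF.
  have := expR_ge1Dx (2 * v ^+ 2); move: (expR _) => w w1 ew.
  have ei0 : 0 < e^-1 by rewrite invr_gt0.
  move: ee ei0 ew; move: e^-1 => f ef f0 ew.
  have : (e + f) ^+ 2 <= (2 * w) ^+ 2 by rewrite ler_sqr ?nnegrE; lra.
  by have := sqr_ge0 (w ^+ 2 - 1); nra.
have [k hk] : exists k : nat, (u / 2 ^+ k) ^+ 2 <= 4^-1.
  have := truncnS_gt (2 * `|u|); move: (Num.truncn _).+1 => k uk; exists k.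
  have : (k%:R : R) <= 2 ^+ k by rewrite -natrX ler_nat ltnW// ltn_expl.
  have : 0 < 2 ^+ k :> R by rewrite exprn_gt0.
  rewrite -real_normK ?num_real// normf_div normrX; set b := 2 ^+ k.
  rewrite (ger0_norm (ler0n _ 2)) -/b => b0 kb.
  have : `|u| / b <= 2^-1 by rewrite ler_pdivrMr//; lra.
  have : 0 <= `|u| / b by rewrite divr_ge0// ltW.
  move: (_ / b) => y; nra.
elim: k u hk => [u|k IHk u hk]; first by rewrite expr0 divr1; exact: small.
have -> : u = 2 * (u / 2) by field.
by apply/double/IHk; move: hk; rewrite (exprS 2 k) invfM mulrA.
Qed.

(* For [g] uniform, the linear form is a sum of independent symmetric variables,
   hence subgaussian; its exponential moment at [s] controls the [p]-th one. *)
Lemma sum_powR_grid_le (I J : finType) (x : J -> R) (h p : R) (a : I -> R) :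
  0 < h -> 1 <= p -> (forall k, `|x k| <= h) ->
  \sum_(g : {ffun I -> bool * J})
    `|\sum_j (-1) ^+ (g j).1 * x (g j).2 * a j| `^ p <=
  #|{ffun I -> bool * J}|%:R *
    (2 * expR 2 * (Num.sqrt p * h * Num.sqrt (\sum_j a j ^+ 2))) `^ p.
Proof.
move=> h0 p1 xh; have p0 : 0 < p by exact: lt_le_trans p1.
pose G := {ffun I -> bool * J}; rewrite -/G; set q := Num.sqrt (\sum_j _).
pose X (g : G) : R := \sum_j (-1) ^+ (g j).1 * x (g j).2 * a j.
have a20 : 0 <= \sum_j a j ^+ 2 by rewrite sumr_ge0// => j _; exact: sqr_ge0.
have [q0|q0] := eqVneq q 0.
  have a0 j : a j = 0.
    move/eqP: q0; rewrite sqrtr_eq0 => q0.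
    have /psumr_eq0P : \sum_j a j ^+ 2 = 0 by apply/eqP; rewrite eq_le q0.
    move=> /(_ (fun i _ => sqr_ge0 _)) /(_ j isT) /eqP.
    by rewrite sqrf_eq0 => /eqP.
  rewrite q0 !mulr0 powR0 ?gt_eqF// mulr0 big1// => g _.
  by rewrite big1 ?normr0 ?powR0 ?gt_eqF// => j _; rewrite a0 mulr0.
have {}q0 : 0 < q by rewrite lt_def q0 sqrtr_ge0.
have sp0 : 0 < Num.sqrt p by rewrite sqrtr_gt0.
(* Chosen so that [s * h * q = sqrt p]: the exponential moment is then of order [exp (2 p)], and
   [p / s] is the scale in the conclusion. *)
pose s := Num.sqrt p / (h * q).
have s0 : 0 < s by rewrite divr_gt0// mulr_gt0.
(* By independence the sum factors over the coordinates; in each factor the two signs pair up to a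
   hyperbolic cosine. *)
have mgf (t : R) : \sum_g expR (t * X g) <= #|G|%:R * expR (2 * (t * h * q) ^+ 2).
  have -> : \sum_g expR (t * X g) =
      \prod_j \sum_(c : bool * J) expR (t * a j * ((-1) ^+ c.1 * x c.2)).
    rewrite (bigA_distr_bigA (fun j (c : bool * J) =>
      expR (t * a j * ((-1) ^+ c.1 * x c.2)))).
    apply: eq_bigr => g _; rewrite -expR_sum mulr_sumr; congr expR.
    by apply: eq_bigr => j _; rewrite mulrCA mulrC mulrA.
  have one j : \sum_(c : bool * J) expR (t * a j * ((-1) ^+ c.1 * x c.2)) <=
      #|{: bool * J}|%:R * expR (2 * (t * h * a j) ^+ 2).
    rewrite -(pair_bigA _ (fun b k => expR (t * a j * ((-1) ^+ (b : bool) * x k)))).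
    rewrite big_bool -big_split/= card_prod card_bool natrM -mulrA.
    have -> : 2 * (#|J|%:R * expR (2 * (t * h * a j) ^+ 2)) =
        \sum_(k : J) 2 * expR (2 * (t * h * a j) ^+ 2).
      by rewrite sumr_const -[RHS]mulr_natl mulrCA.
    apply: ler_sum => k _.
    rewrite addrC expr0 expr1 mul1r mulN1r mulrN (le_trans (cosh_le_expR _))//.
    rewrite ler_wpM2l// ler_expR ler_wpM2l// !exprMn [leLHS]mulrAC.
    rewrite ler_wpM2r ?sqr_ge0// ler_wpM2l ?sqr_ge0//.
    by rewrite -real_normK ?num_real// lerXn2r ?nnegrE// ltW.
  apply: (@le_trans _ _ (\prod_(j : I) (#|{: bool * J}|%:R *
      expR (2 * (t * h * a j) ^+ 2)))).
    apply: ler_prod => j _; rewrite one andbT sumr_ge0// => c _; exact: expR_ge0.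
  rewrite big_split/= prodr_const -natrX -card_ffun -expR_sum.
  rewrite ler_wpM2l// ler_expR -mulr_sumr.
  under eq_bigr do rewrite exprMn.
  by rewrite -mulr_sumr [in leRHS]exprMn sqr_sqrtr.
have mgfabs : \sum_g expR (s * `|X g|) <= #|G|%:R * (2 * expR (2 * p)).
  have shq : s * h * q = Num.sqrt p.
    by rewrite -mulrA divfK// gt_eqF// mulr_gt0.
  have := mgf (- s); rewrite !mulNr sqrrN shq sqr_sqrtr ?(ltW p0)// => mgfN.
  have := mgf s; rewrite shq sqr_sqrtr ?(ltW p0)// => /lerD /(_ mgfN).
  rewrite -mulrDr -mulr2n -[_ *+ 2]mulr_natl; apply: le_trans.
  rewrite -big_split/=; apply: ler_sum => g _.
  by case: (ger0P (X g)) => _; rewrite ?mulrN ?mulNr ?lerDl ?lerDr expR_ge0.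
have B0 : 0 <= Num.sqrt p * h * q by rewrite !mulr_ge0// ltW.
have psE : p / s = Num.sqrt p * h * q.
  by rewrite -{1}[p](sqr_sqrtr (ltW p0)) /s; field; rewrite !gt_eqF.
have pt g : `|X g| `^ p <= (Num.sqrt p * h * q) `^ p * expR (s * `|X g|).
  have si0 : 0 <= s^-1 by rewrite invr_ge0 ltW.
  have sX0 : 0 <= s * `|X g| by rewrite mulr_ge0// ltW.
  rewrite -psE powRM ?(ltW p0)// mulrAC -{1}[`|X g|](mulKf (lt0r_neq0 s0)).
  by rewrite powRM// mulrC ler_wpM2r ?powR_ge0// powR_le_expR.
apply: (le_trans (ler_sum _ (fun g _ => pt g))).
rewrite -mulr_sumr (le_trans (ler_wpM2l (powR_ge0 _ _) mgfabs))//.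
rewrite mulrCA ler_wpM2l// powRM ?mulr_ge0 ?expR_ge0 ?sqrtr_ge0 ?(ltW h0)//.
rewrite [leRHS]mulrC ler_wpM2l ?powR_ge0// powRM ?expR_ge0// -expRM.
(* The factor 2 is absorbed by [2 <= 2 ^ p]. *)
by rewrite ler_wpM2r ?expR_ge0// le1r_powR// ler1n.
Qed.

End powers.

(** * Volume and unions of cubes *)

Section volume.
Context {R : realType}.
Local Notation T := (measurableTypeR R).

Definition tuple_box {n} (I : 'I_n -> set T) : set (n.-tuple T) :=
  [set t | forall i, I i (tnth t i)].

Lemma measurable_tuple_box {n} (I : 'I_n -> set T) :
  (forall i, measurable (I i)) -> measurable (tuple_box I).
Proof.
move=> mI; rewrite (_ : tuple_box I =
    \bigcap_(i in [set: 'I_n]) ((@tnth _ T ^~ i) @^-1` I i)); last first.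
  by apply/seteqP; split => t /= h i; [move=> _|]; exact: h.
apply: fin_bigcap_measurable => [|i _]; first exact: finite_finset.
by rewrite -[X in measurable X]setTI; exact: measurable_tnth.
Qed.

(** An open set is the countable union of the half-open grid cubes of mesh [1 / k.+1] that it
    contains, and these are products of intervals. *)
Lemma measurable_open_rV {n} (U : set 'rV[R]_n) : open U ->
  measurable [set t : n.-tuple T | U (\row_i tnth t i)].
Proof.
move=> oU.
pose B (kz : nat * {ffun 'I_n -> int}) := tuple_box (fun i : 'I_n =>
  `[(kz.2 i)%:~R / kz.1.+1%:R, ((kz.2 i)%:~R + 1) / kz.1.+1%:R[%classic : set T).
pose F kz := if `[< B kz `<=` [set t : n.-tuple T | U (\row_i tnth t i)] >]
  then B kz else set0.
rewrite (_ : mkset _ = \bigcup_kz F kz).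
  apply: countable_bigcupT_measurable; first exact: countableP.
  move=> kz; rewrite /F; case: ifP => // _; apply: measurable_tuple_box => i.
  exact: measurable_itv.
apply/seteqP; split=> [t /= Ut|t [kz _]]; last first.
  by rewrite /F; case: ifPn => // /asboolP; exact.
have /nbhs_ballP[e /= e0 eU] : nbhs (\row_i tnth t i) U.
  by apply: open_nbhs_nbhs; split.
have := truncnS_gt e^-1; move: (Num.truncn _) => k ek.
have k0 : 0 < k.+1%:R :> R by [].
have ke : k.+1%:R^-1 < e by rewrite invf_plt.
pose z := [ffun i => Num.floor (tnth t i * k.+1%:R)].
have tB : B (k, z) t.
  move=> i /=; rewrite in_itv/= ffunE ler_pdivrMr// ltr_pdivlMr// ge_floor/=.
  by rewrite -(intrD _ _ 1); exact: floorD1_gt.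
exists (k, z) => //; rewrite /F; case: ifPn => // /asboolP[] s sB /=.
apply: eU; split => // i j; rewrite !mxE.
move: (tB j) (sB j); rewrite /= !in_itv /=; set y := (z j)%:~R.
rewrite !mulrDl mul1r => /andP[a1 a2] /andP[b1 b2].
have close (a b c d : R) : c <= a -> a < c + d -> c <= b -> b < c + d -> d < e ->
  `|a - b| < e by move=> *; rewrite ltr_norml; apply/andP; split; lra.
exact: close a1 a2 b1 b2 ke.
Qed.

Lemma measurable_closed_rV {n} (A : set 'rV[R]_n) : closed A ->
  measurable [set t : n.-tuple T | A (\row_i tnth t i)].
Proof.
move=> /closed_openC /measurable_open_rV /measurableC.
by rewrite setCK.
Qed.

Lemma tuple_box_cubeE n (I : 'I_n -> interval R) (s : R) :
  (forall i, lebesgue_measure ([set` I i] : set T) = s%:E) ->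
  lebesgue_tuple n (tuple_box (fun i => [set` I i])) = (s ^+ n)%:E.
Proof.
move=> Is; rewrite (@lebesgue_tuple_box R n (fun i => [set` I i])) => [|i]; last first.
  exact: measurable_itv.
by under eq_bigr do rewrite Is; rewrite prodEFin prodr_const card_ord.
Qed.

Lemma volume_le_cubes {n} {I : finType} (P : {set I}) (c : I -> 'I_n -> R) (s : R)
    (A : set 'rV[R]_n) : closed A -> 0 < s ->
  (forall x, A x -> exists2 k, k \in P & forall j, c k j <= x 0 j <= c k j + s) ->
  (volume A <= (#|P|%:R * s ^+ n)%:E)%E.
Proof.
move=> cA s0 AP.
pose B k : set (n.-tuple T) := tuple_box (fun j => `[c k j, c k j + s]%classic : set T).
have mB k : measurable (B k) by apply: measurable_tuple_box => j; exact: measurable_itv.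
have muB k : lebesgue_tuple n (B k) = (s ^+ n)%:E.
  apply: tuple_box_cubeE => j; rewrite lebesgue_measure_itv/= lte_fin ltrDl s0.
  by rewrite -EFinB addrAC subrr add0r.
have [mU muU] : measurable (\big[setU/set0]_(k in P) B k) /\
    (lebesgue_tuple n (\big[setU/set0]_(k in P) B k) <=
     \sum_(k in P) lebesgue_tuple n (B k))%E.
  elim/big_ind2 : _ => [|A1 b1 A2 b2 [mA1 Ab1] [mA2 Ab2]|k _]; last by split.
  - by split=> //; rewrite measure0.
  - by split; [exact: measurableU|rewrite (le_trans (measureU2 _ _ _))// leeD].
apply: (@le_trans _ _ (lebesgue_tuple n (\big[setU/set0]_(k in P) B k))).
  apply: le_measure; rewrite ?inE//; first exact: measurable_closed_rV.
  move=> t /= /AP[k kP kt]; rewrite -bigcup_seq_cond.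
  exists k; first by rewrite /= mem_index_enum.
  by move=> j; have := kt j; rewrite /= in_itv/= mxE.
rewrite (le_trans muU)// (eq_bigr (fun=> (s ^+ n)%:E)) => [|k _]; last exact: muB.
by rewrite sumEFin sumr_const mulr_natl.
Qed.

Lemma cubes_le_volume {n} {I : finType} (P : {set I}) (c : I -> 'I_n -> R) (s : R)
    (A : set 'rV[R]_n) : closed A -> 0 < s ->
  (forall k l, k != l -> exists j, c k j + s <= c l j \/ c l j + s <= c k j) ->
  (forall k (x : 'rV[R]_n), k \in P -> (forall j, c k j <= x 0 j <= c k j + s) -> A x) ->
  ((#|P|%:R * s ^+ n)%:E <= volume A)%E.
Proof.
move=> cA s0 sep PA.
(* Open cubes, since the separation hypothesis lets closed ones share faces; the volume is the
   same. *)
pose B k : set (n.-tuple T) := tuple_box (fun j => `]c k j, c k j + s[%classic : set T).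
have mB k : measurable (B k) by apply: measurable_tuple_box => j; exact: measurable_itv.
have muB k : lebesgue_tuple n (B k) = (s ^+ n)%:E.
  apply: tuple_box_cubeE => j; rewrite lebesgue_measure_itv/= lte_fin ltrDl s0.
  by rewrite -EFinB addrAC subrr add0r.
have muU : lebesgue_tuple n (\bigcup_(k in [set` enum P]) B k) = (#|P|%:R * s ^+ n)%:E.
  rewrite measure_fin_bigcup//.
  - rewrite -fsbig_seq ?enum_uniq//.
    rewrite (eq_bigr (fun=> (s ^+ n)%:E)) => [|k _]; last exact: muB.
    by rewrite big_enum/= sumEFin sumr_const mulr_natl.
  - apply/trivIsetP => k l _ _ /sep[j kl]; rewrite -subset0 => t [/(_ j) /= + /(_ j)] /=.
    rewrite !in_itv/= => /andP[k1 k2] /andP[l1 l2].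
    case: kl => kl.
      by have := lt_trans (lt_le_trans k2 kl) l1; rewrite ltxx.
    by have := lt_trans (lt_le_trans l2 kl) k1; rewrite ltxx.
rewrite -muU; apply: le_measure; rewrite ?inE//.
- by apply: fin_bigcup_measurable.
- exact: measurable_closed_rV.
- move=> t [k /=]; rewrite mem_enum => kP kt; apply: (PA k) => // j.
  by have := kt j; rewrite /= in_itv/= mxE => /andP[/ltW -> /ltW ->].
Qed.

End volume.

(** * Convex hulls of sign vectors *)

Section hull.
Context {R : realType} {m n : nat} (V : 'M[R]_(m, n)).

(** The symmetric convex hull of the rows, written as the linear image of a cross-polytope, from
    which it inherits compactness. *)
Definition row_hull : set 'rV[R]_n :=
  [set t *m V | t in [set t : 'rV[R]_m | \sum_i `|t 0 i| <= 1]].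

Lemma row_hull_row i : row_hull (row i V).
Proof.
exists (delta_mx 0 i); last by rewrite -rowE.
rewrite /= (bigD1 i)//= big1 ?addr0 => [|j /negbTE ji].
  by rewrite mxE !eqxx normr1.
by rewrite mxE ji andbF normr0.
Qed.

Lemma row_hull_symmetric : origin_symmetric row_hull.
Proof.
move=> _ [t /= t1 <-]; exists (- t); last by rewrite mulNmx.
by rewrite /=; under eq_bigr do rewrite mxE normrN.
Qed.

Lemma row_hull_convex : convex_set row_hull.
Proof.
move=> _ _ l /set_mem[s /= s1 <-] /set_mem[t /= t1 <-]; apply/mem_set.
have l0 : 0 <= l%:num by []. have l1 : 0 <= 1 - l%:num by rewrite subr_ge0.
exists (l%:num *: s + (1 - l%:num) *: t) => /=; last first.
  by rewrite mulmxDl -!scalemxAl.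
apply: (@le_trans _ _ (\sum_i (l%:num * `|s 0 i| + (1 - l%:num) * `|t 0 i|))).
  apply: ler_sum => i _; rewrite !mxE (le_trans (ler_normD _ _))//.
  by rewrite !normrM (ger0_norm l0) (ger0_norm l1).
rewrite big_split/= -!mulr_sumr; nra.
Qed.

Lemma row_hull_compact : compact row_hull.
Proof.
apply: continuous_compact.
  apply: continuous_subspaceT.
  rewrite (_ : mulmx^~ V = fun t => \sum_i t 0 i *: row i V); last first.
    by apply/funext => t; exact: mulmx_sum_row.
  apply: continuous_big => [|i _ t]; first exact: add_continuous.
  apply: cvgZr_tmp; [exact: (nbhs_filter t)|exact: (@coord_continuous R 1 m 0 i t)].
apply: bounded_closed_compact.
  exists 1; split => // M M1 t /= t1; apply: le_trans (ltW M1).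
  rewrite [leLHS]/Num.norm/= mx_normrE; apply/bigmax_leP; split => // -[i j] _ /=.
  by rewrite ord1 (le_trans _ t1)// (bigD1 j)//= lerDl sumr_ge0.
apply: (@closed_comp _ _ (fun t : 'rV[R]_m => \sum_i `|t 0 i|) [set x | x <= 1]).
  move=> t _; move: t; apply: continuous_big => [|i _ t]; first exact: add_continuous.
  apply: (continuous_comp (@coord_continuous R 1 m 0 i t)); exact: norm_continuous.
exact: closed_le.
Qed.

(** A left inverse [B] of [V] writes [x] as [x *m B *m V], and the l_1 norm of [x *m B] is at most
    [C] times the sup norm of [x]. *)
Lemma row_hull_interior : row_full V -> (row_hull)° !=set0.
Proof.
move=> /row_fullP[B BV]; exists 0.
pose C := \sum_i \sum_j `|B j i|.
have C0 : 0 <= C by rewrite !sumr_ge0// => i _; rewrite sumr_ge0.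
apply/nbhs_ballP; exists (1 + C)^-1 => /=; first by rewrite invr_gt0 ltr_wpDr.
move=> x [_ x1]; exists (x *m B); last by rewrite -mulmxA BV mulmx1.
apply: (@le_trans _ _ ((1 + C)^-1 * C)); last first.
  by rewrite ler_pdivrMl ?ltr_wpDr// mulr1 lerDr.
rewrite /= mulr_sumr; apply: ler_sum => i _; rewrite mxE mulr_sumr.
rewrite (le_trans (ler_norm_sum _ _ _))//; apply: ler_sum => j _.
rewrite normrM ler_wpM2r//.
by have := x1 0 j; rewrite /ball/= mxE sub0r normrN => /ltW.
Qed.

End hull.

(* For a point [t *m V] of the hull, [round_sqr_sum] replaces [n *: t] by an integer
   vector [z]; the error, divided by [n], has Euclidean norm at most [sqrt 448], and is
   located on the grid of mesh [n^(-1/2)]. With [m = 448 n] there are at most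
   [2 ^ (2 m + (n + m))] vectors [z] and [2 ^ (2 n + 23 n)] grid points. *)
Lemma row_hull_volume (R : realType) : exists2 C : R, 0 < C &
  forall n (V : 'M[R]_(448 * n, n)), (0 < n)%N -> (forall i j, V i j ^+ 2 = 1) ->
    (volume (row_hull V) <= ((C / Num.sqrt n%:R) ^+ n)%:E)%E.
Proof.
(* [1370 = (3 * 448 + 1) + (2 + 23)], for the integer vectors and the grid points. *)
exists (2 ^+ 1370); first by rewrite exprn_gt0.
move=> n V n0 V1; set m := (448 * n)%N in V V1 *.
have n0R : 0 < n%:R :> R by rewrite ltr0n.
have sn0 : 0 < Num.sqrt n%:R :> R by rewrite sqrtr_gt0.
have snE : Num.sqrt n%:R ^+ 2 = n%:R :> R by rewrite sqr_sqrtr// ltW.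
pose Z1 := [set c : {ffun 'I_m -> bool * 'I_(n + m).+1} |
  (\sum_i (c i).2 <= n + m)%N]%SET.
pose Z2 := [set c : {ffun 'I_n -> bool * 'I_(23 * n).+1} |
  (\sum_i (c i).2 <= 23 * n)%N]%SET.
pose corner (c : {ffun 'I_m -> bool * 'I_(n + m).+1} *
    {ffun 'I_n -> bool * 'I_(23 * n).+1}) (j : 'I_n) : R :=
  n%:R^-1 * (\sum_i signed_val (c.1 i) * V i j) +
  signed_val (c.2 j) / Num.sqrt n%:R.
have cardZ : (#|finset.setX Z1 Z2| <= 2 ^ (1370 * n))%N.
  rewrite cardsX (leq_trans (leq_mul (card_l1_ball _ _ _) (card_l1_ball _ _ _)))//.
  rewrite !card_ord -(expnM 2 2) -(expnM 2 2) -!expnD leq_exp2l//.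
  by rewrite eq_leq// /m; ring.
have -> : ((2 ^+ 1370 / Num.sqrt n%:R) ^+ n : R) =
    (2 ^ (1370 * n))%N%:R * (Num.sqrt n%:R)^-1 ^+ n.
  by rewrite exprMn -exprM natrX.
apply: (@le_trans _ _ (#|finset.setX Z1 Z2|%:R * (Num.sqrt n%:R)^-1 ^+ n)%:E).
  apply: (volume_le_cubes _ corner).
  - by apply: compact_closed; [exact: norm_hausdorff|exact: row_hull_compact].
  - by rewrite invr_gt0.
  move=> _ [t /= t1 <-].
  have [] := round_sqr_sum m n (fun i j => V i j) n%:R (fun i => n%:R * t 0 i).
    move=> i; under eq_bigr do rewrite V1.
    by rewrite sumr_const card_ord.
  move=> z [z1 zV].
  have [c1 c1Z c1E] : exists2 c : {ffun 'I_m -> bool * 'I_(n + m).+1},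
      (\sum_i (c i).2 <= n + m)%N & forall i, signed_val (c i) = (z i)%:~R :> R.
    apply: signed_val_code.
    apply: (@le_trans _ _ (\sum_i (n%:R * `|t 0 i| + 1))).
      apply: ler_sum => i _; rewrite intr_norm.
      rewrite -[(z i)%:~R](subKr (n%:R * t 0 i)) (le_trans (ler_normB _ _))//.
      by rewrite lerD// normrM ger0_norm// ltW.
    rewrite big_split/= -mulr_sumr sumr_const card_ord natrD lerD//.
    by rewrite -[leRHS]mulr1 ler_wpM2l// ltW.
  pose b j := \sum_i (n%:R * t 0 i - (z i)%:~R) * V i j.
  (* The error [b / n] in units of the mesh; its floor indexes the cell. *)
  pose w j := b j / n%:R * Num.sqrt n%:R.
  pose y j := Num.floor (w j).
  have yw j : (y j)%:~R <= w j <= (y j)%:~R + 1.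
    by rewrite ge_floor/= -(intrD _ _ 1) ltW// floorD1_gt.
  have [c2 c2Z c2E] : exists2 c : {ffun 'I_n -> bool * 'I_(23 * n).+1},
      (\sum_i (c i).2 <= 23 * n)%N & forall i, signed_val (c i) = (y i)%:~R :> R.
    apply: signed_val_code.
    (* [22 ^ 2 = 484] is at least 448; taking the floor costs 1 more per coordinate, hence 23. *)
    have wS : \sum_j `|w j| <= 22 * n%:R.
      rewrite -ler_sqr ?nnegrE ?mulr_ge0 ?sumr_ge0 ?(ltW n0R)//.
      rewrite (le_trans (sqr_sum_norm_le _ _))// card_ord.
      under eq_bigr do rewrite !exprMn snE.
      rewrite -!mulr_suml.
      have : \sum_j b j ^+ 2 <= 448 * n%:R * n%:R.
        by rewrite (le_trans zV)// /m natrM.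
      set B := \sum_j _; move=> Bn.
      have -> : n%:R * (B * n%:R^-1 ^+ 2 * n%:R) = B by field; rewrite gt_eqF.
      by rewrite (le_trans Bn)//; have := sqr_ge0 (n%:R : R); rewrite !expr2; lra.
    have : \sum_j `|y j|%:~R <= \sum_j (`|w j| + 1) :> R.
      apply: ler_sum => j _; rewrite intr_norm.
      have /andP[h1 h2] := yw j.
      by rewrite ler_norml; case: (ger0P (w j)) => w0; apply/andP; split; lra.
    rewrite big_split/= sumr_const card_ord => /le_trans; apply.
    by rewrite natrM; lra.
  exists (c1, c2); first by rewrite finset.in_setX !inE c1Z c2Z.
  move=> j; have -> : (t *m V) 0 j = n%:R^-1 * (\sum_i (z i)%:~R * V i j) + b j / n%:R.
    rewrite mxE /b mulrC -mulrDl -big_split/=.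
    under [in RHS]eq_bigr do rewrite -mulrDl addrC subrK -mulrA.
    by rewrite -mulr_sumr mulrAC divff ?mul1r// gt_eqF.
  rewrite /corner/=; under eq_bigr do rewrite c1E.
  rewrite c2E -addrA !lerD2l; have /andP[yw1 yw2] := yw j.
  rewrite ler_pdivrMr// yw1/=.
  have -> : (y j)%:~R / Num.sqrt n%:R + (Num.sqrt n%:R)^-1 =
    ((y j)%:~R + 1) / Num.sqrt n%:R :> R by rewrite mulrDl mul1r.
  by rewrite ler_pdivlMr.
by rewrite lee_fin ler_wpM2r ?ler_nat// exprn_ge0// invr_ge0 ltW.
Qed.

(** * Cubes inside unit balls of L_p *)

Lemma measurable_powR_norm {R : realType} {d} {T : measurableType d} (p : R)
    (g : T -> R) :
  measurable_fun setT g -> measurable_fun setT (fun t => (`|g t| `^ p)%:E).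
Proof.
move=> mg; apply: measurableT_comp => //.
by apply: (measurableT_comp (measurable_powR _)) => //; exact: measurableT_comp.
Qed.

Lemma ae_eq_integral_powR {R : realType} {d} {T : measurableType d}
    (mu : {measure set T -> \bar R}) (p : R) (g1 g2 : T -> R) :
  measurable_fun setT g1 -> measurable_fun setT g2 -> g1 = g2 %[ae mu] ->
  (\int[mu]_t (`|g1 t| `^ p)%:E = \int[mu]_t (`|g2 t| `^ p)%:E)%E.
Proof.
move=> mg1 mg2 g12; apply: ge0_ae_eq_integral => //.
- exact: measurable_powR_norm.
- exact: measurable_powR_norm.
by apply: filterS g12 => t /= g12 _; rewrite g12.
Qed.

Section power_integral.
Context {R : realType} {d} {T : measurableType d} (mu : {measure set T -> \bar R}).
Context {n : nat} (f : 'I_n -> T -> R) (p : R).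
Hypothesis (mf : forall j, measurable_fun setT (f j)).

Definition lin_comb (a : 'I_n -> R) (t : T) : R := \sum_j a j * f j t.

(** For [f] supplied by [Lpn_coordinates], this is the [p]-th power of the norm with unit ball
    [D]. *)
Definition pow_integral (a : 'I_n -> R) : \bar R :=
  (\int[mu]_t (`|lin_comb a t| `^ p)%:E)%E.

Lemma measurable_pow_lin_comb a :
  measurable_fun setT (fun t => (`|lin_comb a t| `^ p)%:E).
Proof.
apply: measurable_powR_norm; apply: measurable_sum => j; exact: measurable_funM.
Qed.

Lemma pow_integral_ge0 a : (0 <= pow_integral a)%E.
Proof. by apply: integral_ge0 => t _; rewrite lee_fin powR_ge0. Qed.

(** Apply the scalar inequality at [th = f ^~ t] for each [t] and integrate: moment inequalities for
    linear forms become inequalities between norms. *)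
Lemma sum_pow_integral_le {I J : finType} (a : I -> 'I_n -> R) (b : J -> 'I_n -> R)
    (c1 c2 : R) : 0 <= c1 -> 0 <= c2 ->
  (forall th : 'I_n -> R, c1 * \sum_i `|\sum_j a i j * th j| `^ p <=
     c2 * \sum_i `|\sum_j b i j * th j| `^ p) ->
  (c1%:E * \sum_i pow_integral (a i) <= c2%:E * \sum_i pow_integral (b i))%E.
Proof.
move=> c10 c20 ab.
have E (K : finType) (e : K -> 'I_n -> R) (c : R) : 0 <= c ->
    (c%:E * \sum_i pow_integral (e i))%E =
    (\int[mu]_t (c * \sum_i `|lin_comb (e i) t| `^ p)%:E)%E.
  move=> c0; rewrite /pow_integral -ge0_integral_sum//; last first.
    by move=> i; exact: measurable_pow_lin_comb.
  rewrite -ge0_integralZl_EFin//; last 2 first.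
  - by move=> t _; apply: sume_ge0 => i _; rewrite lee_fin powR_ge0.
  - by apply: emeasurable_sum => i; exact: measurable_pow_lin_comb.
  by apply: eq_integral => t _; rewrite sumEFin EFinM.
have mE (K : finType) (e : K -> 'I_n -> R) (c : R) :
    measurable_fun setT (fun t => (c * \sum_i `|lin_comb (e i) t| `^ p)%:E).
  apply: measurableT_comp => //; apply: measurable_funM => //.
  apply: measurable_sum => i; apply/measurable_EFinP.
  exact: measurable_pow_lin_comb.
rewrite !E//; apply: ge0_le_integral => //.
- by move=> t _; rewrite lee_fin mulr_ge0// sumr_ge0// => i _; exact: powR_ge0.
- by move=> t _; rewrite lee_fin; exact: ab.
Qed.

Lemma pow_integral_scale (s : R) (a : 'I_n -> R) : 0 <= s ->
  (pow_integral (fun j => (s * a j)%R) <= (s `^ p)%:E * pow_integral a)%E.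
Proof.
move=> s0.
have := @sum_pow_integral_le 'I_1 'I_1 (fun _ j => s * a j) (fun=> a) 1 (s `^ p).
rewrite !big_ord1 mul1e; apply => // [|th]; first exact: powR_ge0.
rewrite !big_ord1 mul1r -powRM// -[s in leRHS]ger0_norm// -normrM mulr_sumr.
by under eq_bigr do rewrite -mulrA.
Qed.

End power_integral.

Lemma powR_half_add_le {R : realType} (p a b : R) : 1 <= p -> 0 <= a -> 0 <= b ->
  (a + b) `^ p <= 2^-1 * ((2 * a) `^ p + (2 * b) `^ p).
Proof.
move=> p1 a0 b0.
have := @powR_mean_le _ bool (fun c => if c then 2 * a else 2 * b) p p1.
rewrite !big_bool card_bool/= -mulrDr mulrAC divff// mul1r => h.
by rewrite ler_pdivlMl//; apply: h => // -[]; exact: mulr_ge0.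
Qed.

(* A grid of mesh [h / K] replaces the cube [-h, h]^n: since [p]-th moments of linear
   forms on the grid are dominated by those on the rows of [V], half of the grid points
   have [pow_integral] at most [2^-p], hence at most [1] throughout their cells. *)
Section cube_grid.
Context {R : realType} {d} {T : measurableType d} (mu : {measure set T -> \bar R}).
Context {n m : nat} (V : 'I_m -> 'I_n -> R) (f : 'I_n -> T -> R) (p : R).
Hypotheses (n0 : (0 < n)%N) (m0 : (0 < m)%N) (p1 : 1 <= p).
Hypothesis mf : forall j, measurable_fun setT (f j).
Hypothesis VE : forall a : 'I_n -> R,
  m%:R * Num.sqrt (\sum_j a j ^+ 2) <= 29 * \sum_i `|\sum_j V i j * a j|.
Hypothesis V1 : forall i, (pow_integral mu f p (V i) <= 1)%E.

(** Makes the constant of [sum_powR_grid_le] equal to [1 / 116], where [116 = 4 * 29]: 29 offsets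
    [VE] and 4 remains as a margin. *)
Let h : R := (232 * expR 2 * Num.sqrt p)^-1.

Let p0 : 0 < p. Proof. exact: lt_le_trans p1. Qed.

Let h0 : 0 < h.
Proof. by rewrite invr_gt0 !mulr_gt0 ?expR_gt0// sqrtr_gt0. Qed.

Context (K : nat).
Local Notation G := {ffun 'I_n -> bool * 'I_K}.
(** The vertex nearest to the origin of the cell [g]. On each axis the [2 K] codes stand for the
    [2 K] intervals that divide [[-h, h]], so 0 rightly has two codes. *)
Let grid (g : G) j : R := (-1) ^+ (g j).1 * (h * (g j).2%:R / K%:R).

(** The grid moment is at most [(|a| / 116) ^ p] on average, [VE] bounds [|a|] by 29 times the mean
    of the forms, and [powR_mean_le] moves the power inside that mean. *)
Let sum_grid_le (a : 'I_n -> R) :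
  m%:R * \sum_g `|\sum_j grid g j * a j| `^ p <=
  #|G|%:R * 4^-1 `^ p * \sum_i `|\sum_j V i j * a j| `^ p.
Proof.
pose F := \sum_i `|\sum_j V i j * a j|; have F0 : 0 <= F by rewrite sumr_ge0.
have m0R : 0 < m%:R :> R by rewrite ltr0n.
have xh (k : 'I_K) : `|h * k%:R / K%:R| <= h.
  rewrite ger0_norm ?divr_ge0 ?mulr_ge0 ?(ltW h0)//.
  have K0 : 0 < K%:R :> R by rewrite ltr0n (leq_ltn_trans _ (ltn_ord k)).
  by rewrite ler_pdivrMr// ler_wpM2l ?(ltW h0)// ler_nat ltnW.
have := sum_powR_grid_le 'I_n _ (fun k : 'I_K => h * k%:R / K%:R) h p a h0 p1 xh.
set S := \sum_g _ => hS.
have qF : 2 * expR 2 * (Num.sqrt p * h * Num.sqrt (\sum_j a j ^+ 2)) <= 4^-1 * (F / m%:R).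
  have -> : 2 * expR 2 * (Num.sqrt p * h * Num.sqrt (\sum_j a j ^+ 2)) =
      116^-1 * Num.sqrt (\sum_j a j ^+ 2).
    by rewrite /h; field; rewrite !gt_eqF ?expR_gt0 ?sqrtr_gt0.
  rewrite mulrA ler_pdivlMr//; have := VE a; rewrite -/F; lra.
have q0 : 0 <= 2 * expR 2 * (Num.sqrt p * h * Num.sqrt (\sum_j a j ^+ 2)).
  by rewrite !mulr_ge0 ?expR_ge0 ?sqrtr_ge0 ?(ltW h0).
have {}hS : S <= #|G|%:R * (4^-1 `^ p * (F / m%:R) `^ p).
  rewrite (le_trans hS)// ler_wpM2l// -powRM ?divr_ge0//.
  by rewrite ge0_ler_powR ?nnegrE ?mulr_ge0 ?divr_ge0// ltW.
apply: (le_trans (ler_wpM2l (ltW m0R) hS)).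
rewrite mulrCA -[leRHS]mulrA ler_wpM2l// mulrCA ler_wpM2l ?powR_ge0//.
have := powR_mean_le _ (fun i => `|\sum_j V i j * a j|) p p1.
by rewrite card_ord -/F; apply.
Qed.

Let good : {set G} := [set g | (pow_integral mu f p (grid g) <= (2^-1 `^ p)%:E)%E]%SET.

(** Markov's inequality: the mean over the grid is at most [4 ^ (- p)], so at most a fraction
    [2 ^ (- p) <= 1 / 2] of the points exceeds [2 ^ (- p)]. *)
Let card_good : (#|G| <= 2 * #|good|)%N.
Proof.
have m0R : 0 < m%:R :> R by rewrite ltr0n.
have := sum_pow_integral_le mu f p mf grid V m%:R (#|G|%:R * 4^-1 `^ p).
move=> /(_ (ler0n _ _)); rewrite mulr_ge0 ?powR_ge0// => /(_ isT sum_grid_le) sG.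
have bad : (m%:R%:E * ((#|~: good|%:R * 2^-1 `^ p)%:E) <=
    (#|G|%:R * 4^-1 `^ p)%:E * m%:R%:E :> \bar R)%E.
  apply: le_trans (le_trans _ sG) _.
    rewrite lee_wpmul2l ?lee_fin//.
    rewrite [leRHS](bigID (fun g => g \in ~: good))/=.
    rewrite -[leLHS]adde0 leeD//; last first.
      by apply: sume_ge0 => g _; exact: pow_integral_ge0.
    rewrite mulr_natl -sumr_const -sumEFin; apply: lee_sum => g.
    by rewrite !inE -ltNge => /ltW.
  rewrite lee_wpmul2l ?lee_fin ?mulr_ge0 ?powR_ge0//.
  apply: (@le_trans _ _ (\sum_(i < m) 1)%E); first by apply: lee_sum => i _; exact: V1.
  by rewrite sumEFin sumr_const card_ord.
move: bad; rewrite -!EFinM lee_fin mulrC ler_pM2r//.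
have -> : 4^-1 = 2^-1 * 2^-1 :> R by field.
rewrite powRM// mulrA ler_pM2r ?powR_gt0// => bad.
have : #|~: good|%:R <= #|G|%:R * 2^-1 :> R.
  rewrite (le_trans bad)// ler_wpM2l// ge1r_powR//; lra.
rewrite ler_pdivlMr// -natrM ler_nat; have := cardsC good.
move: #|good| #|~: good| #|G| => x y _ <-.
by rewrite muln2 mul2n -!addnn leq_add2r leq_add2l.
Qed.

Hypothesis K0 : (0 < K)%N.
Hypothesis KE : (\sum_(j < n)
  pow_integral mu f p (fun i => (2 * n%:R * h / K%:R * (i == j)%:R)%R) <= 1)%E.

(** Convexity, twice: [x] is the midpoint of twice the grid point and twice the error, and the bound
    [2 * B] on the latter form is the mean of the [n] numbers [2 n h / K * |a j|]. *)
Let near_grid_le (g : G) (x a : 'I_n -> R) : (forall j, `|x j - grid g j| <= h / K%:R) ->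
  `|\sum_j x j * a j| `^ p <= 2^-1 * (`|\sum_j 2 * grid g j * a j| `^ p +
    \sum_(j < n) `|\sum_i 2 * n%:R * h / K%:R * (i == j)%:R * a i| `^ p).
Proof.
move=> xg; have hK0 : 0 <= h / K%:R by rewrite divr_ge0// ltW.
have n0R : 0 < n%:R :> R by rewrite ltr0n.
pose B := h / K%:R * \sum_j `|a j|.
have B0 : 0 <= B by rewrite mulr_ge0// sumr_ge0.
have xB : `|\sum_j x j * a j| <= `|\sum_j grid g j * a j| + B.
  have -> : \sum_j x j * a j = \sum_j grid g j * a j + \sum_j (x j - grid g j) * a j.
    by rewrite -big_split; apply: eq_bigr => j _ /=; rewrite -mulrDl addrC subrK.
  rewrite (le_trans (ler_normD _ _))// lerD2l /B mulr_sumr.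
  rewrite (le_trans (ler_norm_sum _ _ _))//; apply: ler_sum => j _.
  by rewrite normrM ler_wpM2r.
apply: (@le_trans _ _ ((`|\sum_j grid g j * a j| + B) `^ p)).
  by rewrite ge0_ler_powR ?nnegrE ?addr_ge0// ltW.
rewrite (le_trans (powR_half_add_le _ _ _ _ _ _))// ler_wpM2l//; apply: lerD.
  rewrite -[2 in leLHS]ger0_norm// -normrM mulr_sumr.
  by under eq_bigr do rewrite mulrA.
have := powR_mean_le _ (fun j => `|2 * n%:R * h / K%:R * a j|) p p1.
rewrite card_ord => /(_ (fun _ => normr_ge0 _) n0).
have -> : \sum_j `|2 * n%:R * h / K%:R * a j| `^ p =
    \sum_(j < n) `|\sum_i 2 * n%:R * h / K%:R * (i == j)%:R * a i| `^ p.
  apply: eq_bigr => j _; congr (`|_| `^ p).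
  rewrite (bigD1 j)//= eqxx mulr1 big1 ?addr0// => i /negbTE ->.
  by rewrite mulr0 mul0r.
have -> : (\sum_j `|2 * n%:R * h / K%:R * a j|) / n%:R = 2 * B.
  under eq_bigr do rewrite normrM.
  rewrite -mulr_sumr ger0_norm ?divr_ge0 ?mulr_ge0 ?(ltW h0)// /B.
  by field; rewrite !gt_eqF ?ltr0n.
apply: le_trans; rewrite -[leLHS]mul1r ler_wpM2r ?powR_ge0//.
by rewrite ler1n.
Qed.

Let near_good_le (g : G) (x : 'I_n -> R) : g \in good ->
  (forall j, `|x j - grid g j| <= h / K%:R) -> (pow_integral mu f p x <= 1)%E.
Proof.
rewrite inE => gP xg.
(* One family for the [n + 1] vectors in [near_grid_le]: index 0 is twice the grid point, the others
   are the scaled basis vectors of [KE]. *)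
pose b (i : 'I_n.+1) : 'I_n -> R := if unlift ord0 i is Some j
  then fun i => 2 * n%:R * h / K%:R * (i == j)%:R else fun i => 2 * grid g i.
have := sum_pow_integral_le mu f p mf (fun (_ : 'I_1) => x) b 1 2^-1 ler01.
rewrite big_ord1 mul1e => /(_ _ _)/le_trans; apply => //.
  move=> a; rewrite big_ord1 mul1r big_ord_recl /b unlift_none.
  under [X in _ + X]eq_bigr do rewrite liftK.
  exact: near_grid_le.
rewrite big_ord_recl /b unlift_none; under eq_bigr do rewrite liftK.
have g1 : (pow_integral mu f p (fun i => (2 * grid g i)%R) <= 1)%E.
  rewrite (le_trans (pow_integral_scale _ _ _ _ _ _ _))//.
  rewrite (le_trans (lee_wpmul2l _ gP)) ?lee_fin ?powR_ge0//.
  by rewrite -powRM// divff// powR1.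
rewrite (le_trans (lee_wpmul2l _ (leeD g1 KE)))//.
by rewrite -EFinD -EFinM mulVf.
Qed.

Lemma cube_grid_volume (A : set 'rV[R]_n) : closed A ->
  (forall x : 'rV[R]_n, (pow_integral mu f p (fun j => x 0%R j) <= 1)%E -> A x) ->
  ((h ^+ n)%:E <= volume A)%E.
Proof.
move=> cA fA.
have K0R : 0 < K%:R :> R by rewrite ltr0n.
(* The lower corner of the cell: for a negative sign it lies one step beyond the grid point. *)
pose z (g : G) j : int := if (g j).1 then - ((g j).2.+1)%:Z else (g j).2%:Z.
pose c (g : G) j : R := (z g j)%:~R * (h / K%:R).
have hK0 : 0 < h / K%:R by rewrite divr_gt0.
apply: (@le_trans _ _ (#|good|%:R * (h / K%:R) ^+ n)%:E).
  (* Half of the [(2 K) ^ n] cells is at least [K ^ n] cells, because [n > 0]. *)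
  rewrite lee_fin expr_div_n mulrA ler_pdivlMr ?exprn_gt0// mulrC.
  rewrite ler_wpM2r ?exprn_ge0 ?(ltW h0)// -natrX ler_nat.
  rewrite -(leq_pmul2l (isT : (0 < 2)%N)) (leq_trans _ card_good)//.
  rewrite card_ffun card_prod card_bool !card_ord expnMn leq_mul//.
  by rewrite -[leqLHS]expn1 leq_exp2l.
apply: (cubes_le_volume _ c) => //.
  move=> g g' gg'; have [j gj] : exists j, z g j != z g' j.
    apply/existsP; rewrite -negb_forall; apply: contra gg' => /forallP zz.
    apply/eqP/ffunP => j; move/eqP: (zz j); rewrite /z.
    case: (g j) (g' j) => [[] k] [[] k'] //=.
    - by move=> /oppr_inj [] kk; congr pair; apply: val_inj.
    - by move=> [] kk; congr pair; apply: val_inj.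
  exists j; rewrite /c.
  have step (u v : int) : u < v -> u%:~R * (h / K%:R) + h / K%:R <= v%:~R * (h / K%:R).
    move=> uv; rewrite -[X in _ + X]mul1r -mulrDl ler_wpM2r ?(ltW hK0)//.
    by rewrite -(intrD _ _ 1) ler_int lezD1.
  by move: gj; rewrite neq_lt => /orP[] /step; [left|right].
move=> g x gP xc; apply: fA; apply: (near_good_le g) => // j.
have := xc j; rewrite /c /grid /z -(mulrA h) (mulrCA h) (mulrC h).
move: (x 0 j) hK0 (h / K%:R) => y _ e; case: (g j) => [[] k] /=.
  rewrite mulrNz -pmulrn -natr1 expr1 => /andP[y1 y2].
  by rewrite ler_norml; apply/andP; split; lra.
rewrite -pmulrn expr0 => /andP[y1 y2].
by rewrite ler_norml; apply/andP; split; lra.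
Qed.

End cube_grid.

(** * Outer volume ratio *)

Section Lp_bodies.
Context {R : realType} {n : nat} (p : R).
Hypothesis p1 : 1 <= p.
Local Notation mu := (@lebesgue01 R).
Local Notation F := (measurableTypeR R -> R).

(* Transports the Lebesgue functions to coordinates: [f j] is the preimage under
   the linear isomorphism [E -> R^n] of the [j]-th basis vector. *)
Lemma Lpn_coordinates {m : nat} (V : 'M[R]_(m, n)) (D : set 'rV[R]_n) :
  row_full V -> Lpn p D -> (forall i, D (row i V)) ->
  exists f : 'I_n -> F, [/\ forall j, measurable_fun setT (f j),
    forall a, (pow_integral mu f p a < +oo)%E &
    forall x : 'rV[R]_n, D x <-> (pow_integral mu f p (fun j => x 0%R j) <= 1)%E].
Proof.
move=> Vfull [_ _ [E [T [[ELp E0 Elin Eae] [b [Eb bfree bgen]] [Tlin Tae] DE]]]] VD.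
have p0 : 0 < p by exact: lt_le_trans p1.
have T0 : T 0 = 0.
  have := Tlin 1 0 0 E0 E0; rewrite scaler0 addr0 scale1r.
  by move=> /eqP; rewrite -subr_eq subrr => /eqP.
pose B (c : 'I_n -> R) : F := \sum_k c k *: b k.
pose M : 'M[R]_n := \matrix_k T (b k).
have EB c : E (B c) /\ T (B c) = \sum_k c k *: T (b k).
  rewrite /B; elim/big_ind2 : _ => // [f1 x1 f2 x2 [E1 T1] [E2 T2]|k _].
    have := (Elin 1 _ _ E1 E2, Tlin 1 _ _ E1 E2).
    by rewrite !scale1r T1 T2 => -[].
  have := (Elin (c k) _ _ (Eb k) E0, Tlin (c k) _ _ (Eb k) E0).
  by rewrite T0 !addr0 => -[].
have TB c : T (B c) = (\row_k c k) *m M.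
  rewrite (EB c).2 mulmx_sum_row; apply: eq_bigr => k _.
  by rewrite rowK mxE.
have DB x : D x -> exists2 c, x = (\row_k c k) *m M &
    exists2 g, E g /\ ('N[mu]_p%:E [EFin \o g] <= 1)%E & g = B c %[ae mu].
  rewrite DE => -[g [Eg g1] <-]; have [c gc] := bgen g Eg.
  exists c; last by exists g.
  by rewrite -TB; apply: Tae => //; exact: (EB c).1.
(* The rows of [V] belong to [D], hence to the row space of [M], and they span [R^n]. *)
have Munit : M \in unitmx.
  rewrite -row_full_unit -col_leq_rank; move: Vfull; rewrite -col_leq_rank.
  move=> /leq_trans; apply; apply: mxrankS; apply/row_subP => i.
  by have [c -> _] := DB _ (VD i); exact: submxMl.
pose f j : F := B (fun k => invmx M j k).
have fB (a : 'I_n -> R) : lin_comb f a = B (fun k => ((\row_j a j) *m invmx M) 0 k).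
  apply/funext => t; rewrite /lin_comb /B fct_sumE.
  under eq_bigr do rewrite /f /B fct_sumE mulr_sumr.
  rewrite exchange_big/=; apply: eq_bigr => k _.
  rewrite /= mxE [RHS]mulr_suml; apply: eq_bigr => j _.
  by rewrite mxE -mulrA.
have Ef a : E (lin_comb f a) by rewrite fB; exact: (EB _).1.
have Lf g : E g -> g \in Lfun mu p%:E by exact: ELp.
have mE g : E g -> measurable_fun setT g.
  by move=> /Lf; rewrite inE => /andP[/[!inE]].
have normE g : (('N[mu]_p%:E [EFin \o g] <= 1) =
    (\int[mu]_t (`|g t| `^ p)%:E <= 1))%E.
  have -> : (\int[mu]_t (`|g t| `^ p)%:E = 'N[mu]_p%:E [EFin \o g] `^ p)%E.
    by rewrite poweR_Lnorm// gt_eqF.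
  apply/idP/idP => g1.
    rewrite -(poweR1r p); apply: gt0_ler_poweR => //; first exact: ltW.
      by rewrite in_itv/= Lnorm_ge0 leey.
    by rewrite in_itv/= leey andbT lee_fin.
  have -> : ('N[mu]_p%:E [EFin \o g] = ('N[mu]_p%:E [EFin \o g] `^ p) `^ p^-1)%E.
    by rewrite -poweRrM mulfV ?gt_eqF// poweRe1 ?Lnorm_ge0.
  rewrite -(poweR1r p^-1); apply: gt0_ler_poweR => //.
  - by rewrite invr_ge0 ltW.
  - by rewrite in_itv/= poweR_ge0 leey.
  - by rewrite in_itv/= leey andbT lee_fin.
exists f; split.
- by move=> j; apply: mE; exact: (EB _).1.
- move=> a; have /(Lfun_integrable p1)/integrableP[_] := Lf _ (Ef a).
  apply: le_lt_trans; rewrite /pow_integral le_eqVlt; apply/orP; left; apply/eqP.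
  by apply: eq_integral => t _; rewrite gee0_abs// lee_fin powR_ge0.
move=> x; split=> [/DB[c xc [g [Eg g1] gc]]|x1].
  move: g1; rewrite normE; apply: le_trans; rewrite le_eqVlt; apply/orP; left; apply/eqP.
  have cx : lin_comb f (fun j => x 0 j) = B c.
    rewrite fB; congr B; apply/funext => k.
    have -> : \row_j x 0 j = x by apply/rowP => j; rewrite mxE.
    by rewrite xc mulmxK// mxE.
  rewrite /pow_integral cx; apply: ae_eq_integral_powR.
  - exact: (mE _ (EB c).1).
  - exact: mE.
  - exact: ae_eq_sym.
rewrite DE; exists (lin_comb f (fun j => x 0 j)); first by split=> //; rewrite normE.
rewrite fB TB; have -> : \row_j x 0 j = x by apply/rowP => j; rewrite mxE.
have -> : \row_k (x *m invmx M) 0 k = x *m invmx M by apply/rowP => j; rewrite mxE.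
by rewrite mulmxKV.
Qed.

End Lp_bodies.

Theorem corollary1p2 (R : realType) :
  exists c : R, 0 < c /\
    forall n : nat, (0 < n)%N ->
      exists L : set 'rV[R]_n,
        [/\ origin_symmetric L, convex_body L &
          forall p : R, 1 <= p ->
            ((c * (Num.sqrt n%:R / Num.sqrt p))%:E <= d_ovr L p)%E].
Proof.
have [C C0 hull_le] := row_hull_volume R.
pose b : R := 232 * expR 2.
have b0 : 0 < b by rewrite mulr_gt0 ?expR_gt0 ?ltr0n.
exists (b^-1 / C); split; first by rewrite divr_gt0 ?invr_gt0.
move=> n n0; have [V [V1 VE]] := @exists_sign_vectors R n n0.
set m := (448 * n)%N in V V1 VE.
have m0 : (0 < m)%N by rewrite muln_gt0.
pose W : 'M[R]_(m, n) := \matrix_(i, j) V i j.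
have m0R : 0 < m%:R :> R by rewrite ltr0n.
(* Each column of the cokernel is annihilated by all rows of [W], so [VE] forces its Euclidean norm
   to vanish. *)
have Wfull : row_full W.
  rewrite -cokermx_eq0; apply/eqP/matrixP => j k; rewrite [RHS]mxE.
  have := VE (fun j => cokermx W j k).
  rewrite (_ : \sum_i `|\sum_j V i j * cokermx W j k| = 0) ?mulr0; last first.
    apply: big1 => i _; have := mulmx_coker W.
    move=> /(congr1 (fun X : matrix R m n => X i k)); rewrite [RHS]mxE mxE => Wk.
    apply/eqP; rewrite normr_eq0; apply/eqP; rewrite -[RHS]Wk.
    by apply: eq_bigr => l _; rewrite [W i l]mxE.
  rewrite pmulr_rle0// => s0.
  have {}s0 : Num.sqrt (\sum_j cokermx W j k ^+ 2) == 0 by rewrite eq_le s0 sqrtr_ge0.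
  rewrite sqrtr_eq0 in s0.
  have /psumr_eq0P : \sum_j cokermx W j k ^+ 2 = 0.
    by apply/eqP; rewrite eq_le s0 sumr_ge0// => l _; exact: sqr_ge0.
  by move=> /(_ (fun l _ => sqr_ge0 _)) /(_ j isT) /eqP; rewrite sqrf_eq0 => /eqP.
exists (row_hull W); split.
- exact: row_hull_symmetric.
- split; [exact: row_hull_convex|exact: row_hull_compact|exact: row_hull_interior].
move=> p p1; apply: le_ereal_inf_tmp => _ [D [LpD LD] <-].
have [f [mf f_fin fD]] := Lpn_coordinates p p1 W D Wfull LpD
  (fun i => LD _ (row_hull_row W i)).
have n0R : 0 < n%:R :> R by rewrite ltr0n.
have sp0 : 0 < Num.sqrt p by rewrite sqrtr_gt0 (lt_le_trans ltr01).
pose h : R := (b * Num.sqrt p)^-1.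
have h0 : 0 < h by rewrite invr_gt0 mulr_gt0.
have VD i : (pow_integral (@lebesgue01 R) f p (V i) <= 1)%E.
  rewrite (_ : V i = fun j => row i W 0 j); first exact/fD/LD/row_hull_row.
  by apply/funext => j; rewrite !mxE.
have hD : ((h ^+ n)%:E <= volume D)%E.
  pose S := (\sum_(j < n) pow_integral (@lebesgue01 R) f p (fun i => (i == j)%:R))%E.
  have [M M0 SM] : exists2 M : R, 0 <= M & S = M%:E.
    have S0 : (0 <= S)%E by apply: sume_ge0 => j _; exact: pow_integral_ge0.
    have : (S < +oo)%E by apply: lte_sum_pinfty => j _; exact: f_fin.
    by case: S S0 => [M M0 _|//|//]; exists M.
  (* [K] may depend on [D] and [p], as it does not enter the volume bound. Using [M + 1] gives
     [e <= 1], so [e ^ p * M <= e * M <= 1]. *)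
  have := truncnS_gt (2 * n%:R * h * (M + 1)); set K := (Num.truncn _).+1 => KM.
  have K0R : 0 < K%:R :> R by [].
  pose e := 2 * n%:R * h / K%:R.
  have e0 : 0 < e by rewrite divr_gt0// !mulr_gt0.
  have eM : e * (M + 1) <= 1 by rewrite mulrAC ler_pdivrMr// mul1r ltW.
  have e1 : e <= 1 by nra.
  apply: (cube_grid_volume (@lebesgue01 R) V f p n0 m0 p1 mf VE VD K) => //.
  - apply: (@le_trans _ _ (\sum_(j < n)
      (e `^ p)%:E * pow_integral (@lebesgue01 R) f p (fun i => (i == j)%:R))%E).
      by apply: lee_sum => j _; apply: pow_integral_scale mf _ _ (ltW e0).
    rewrite -ge0_sume_distrr => [|j _]; last exact: pow_integral_ge0.
    rewrite -/S SM -EFinM lee_fin (le_trans _ eM)// ler_pM ?powR_ge0//.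
      by rewrite ge1r_powR// e0.
    by rewrite lerDl.
  - by case: LpD => _ [_ + _] _; apply: compact_closed; exact: norm_hausdorff.
  - by move=> x; rewrite -fD.
pose q := C / Num.sqrt n%:R.
have q0 : 0 < q by rewrite divr_gt0// sqrtr_gt0.
have LV : ((q ^+ n)^-1%:E <= (volume (row_hull W))^-1)%E.
  have -> : ((q ^+ n)^-1%:E = ((q ^+ n)%:E)^-1)%E.
    by rewrite inver gt_eqF// exprn_gt0.
  rewrite lee_pV2 ?inE ?measure_ge0 ?lee_fin ?exprn_ge0 ?(ltW q0)//.
  by apply: hull_le => // i j; rewrite mxE.
(* [h ^ n] bounds the volume of [D] from below and [q ^ n] that of the hull from above, so the
   target is the ratio [h / q]. *)
have -> : b^-1 / C * (Num.sqrt n%:R / Num.sqrt p) = h / q.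
  by rewrite /h /q invf_div (invfM b) mulrACA [RHS]mulrACA [C^-1 * _]mulrC.
have -> : (h / q)%:E = ((h ^+ n * (q ^+ n)^-1)%:E `^ n%:R^-1)%E.
  have hq0 : 0 <= h / q by rewrite divr_ge0// ltW.
  by rewrite -expr_div_n -(powR_mulrn n hq0) poweR_EFin -powRrM mulfV ?gt_eqF// powRr1.
have D0 : (0 <= volume D)%E by exact: measure_ge0.
apply: gt0_ler_poweR.
- by rewrite invr_ge0.
- by rewrite in_itv/= leey andbT lee_fin mulr_ge0// ?invr_ge0 exprn_ge0// ltW.
- rewrite in_itv/= leey andbT (le_trans _ (lee_pmul _ _ hD LV))//;
    by rewrite ?lee_fin ?mulr_ge0 ?invr_ge0 ?exprn_ge0 ?(ltW h0) ?(ltW q0).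
by rewrite EFinM lee_pmul// lee_fin ?invr_ge0 exprn_ge0// ltW.
Qed.
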